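(* Let $D$ be a direct tract of $f$, let $M_D(r)=\max_{|z|=r,\,z\in D}|f(z)|$, and let $\rho_0>R$ be such that $M_D(\rho)>\rho$ for all $\rho>\rho_0$. Then for every $\rho>\rho_0$ all components of $$A(f,D,\rho)=\{z\in D: f^n(z)\in D\text{ and }|f^n(z)|\ge M_D^n(\rho)\text{ for all }n\in\mathbb{N}\}$$ are unbounded.
   Context: A direct tract of $f$: $D$ is an unbounded domain with piecewise smooth boundary curves and unbounded complement; $f$ is defined on $\overline{D}$, holomorphic in $D$, continuous on $\overline{D}$, and there is $R>0$ with $|f|=R$ on $\partial D$ and $|f|>R$ in $D$. $M_D^n$ denotes the $n$-th iterate of $M_D$. *)

(* Defs.v *)
From mathcomp Require Import all_boot all_order all_algebra.
From mathcomp Require Import complex.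
From mathcomp Require Import all_classical all_reals all_analysis.
Import Order.TTheory GRing.Theory Num.Theory numFieldNormedType.Exports.

Set Implicit Arguments.
Unset Strict Implicit.
Unset Printing Implicit Defensive.

Local Open Scope ring_scope.
Local Open Scope classical_set_scope.

Definition Cx (R : realType) : numClosedFieldType := R[i].

Definition cabs (R : realType) (z : Cx R) : R := Normc.normc z.

Definition unbounded (R : realType) (A : set (Cx R)) : Prop :=
  forall M : R, exists z, A z /\ M < cabs z.

Definition domain (R : realType) (D : set (Cx R)) : Prop :=
  D !=set0 /\ open D /\ connected D.

Definition piecewise_smooth (R : realType) (g : R -> Cx R) : Prop :=
  continuous g /\
  exists S : set R,
    (forall a b : R, finite_set (S `&` [set x | a <= x <= b])) /\
    forall t, ~ S t ->
      derivable (fun s => complex.Re (g s)) t 1 /\ derivable (fun s => complex.Im (g s)) t 1 /\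
      {for t, continuous (fun s => (fun u => complex.Re (g u))^`() s)} /\
      {for t, continuous (fun s => (fun u => complex.Im (g u))^`() s)}.

(* A (simple) boundary curve: either a Jordan arc parametrised injectively by R,
   or a Jordan closed curve, i.e. periodic and injective on one period. *)
Definition simple_curve (R : realType) (g : R -> Cx R) : Prop :=
  injective g \/
  exists T : R, 0 < T /\ (forall t, g (t + T) = g t) /\
    forall s t, 0 <= s < T -> 0 <= t < T -> g s = g t -> s = t.

Definition piecewise_smooth_boundary (R : realType) (D : set (Cx R)) : Prop :=
  exists Gamma : set (R -> Cx R),
    (forall g, Gamma g -> piecewise_smooth g /\ simple_curve g) /\
    (forall K : set (Cx R), compact K ->
       finite_set [set g | Gamma g /\ (range g `&` K) !=set0]) /\
    closure D `\` D = \bigcup_(g in Gamma) range g.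

(* holomorphic on an open set: complex differentiable at every point *)
Definition holomorphic_on (R : realType) (f : Cx R -> Cx R) (D : set (Cx R)) :=
  forall z, D z -> derivable f z 1.

(* D is a direct tract of f with level Rt (the "R" of the paper). f is a total
   function C -> C, only its values on closure D matter. *)
Definition direct_tract (R : realType) (f : Cx R -> Cx R) (D : set (Cx R))
    (Rt : R) : Prop :=
  domain D /\ unbounded D /\ piecewise_smooth_boundary D /\ unbounded (~` D) /\
  holomorphic_on f D /\ {within closure D, continuous f} /\
  0 < Rt /\
  (forall z, (closure D `\` D) z -> cabs (f z) = Rt) /\
  (forall z, D z -> Rt < cabs (f z)).

Definition MD (R : realType) (f : Cx R -> Cx R) (D : set (Cx R)) (r : R) : R :=
  sup [set cabs (f z) | z in [set z | D z /\ cabs z = r]].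

Definition A_set (R : realType) (f : Cx R -> Cx R) (D : set (Cx R)) (rho : R)
  : set (Cx R) :=
  [set z | D z /\ forall n : nat,
     D (iter n f z) /\ iter n (MD f D) rho <= cabs (iter n f z)].

(* Main.v *)
(* Let X_n be the closed set of points whose first n iterates satisfy the constraints
   defining A = A(f, D, rho), so that A is the intersection of the X_n.  If the
   component of z in A were bounded, a relatively clopen compact piece of A would
   contain z, hence there would be a bounded open set O containing z whose boundary
   misses A and, by compactness, misses some X_n.  Then X_n meets the closure of O in
   a compact subset of O, at a point of which |f^n| is maximal; by the monotonicity of
   M_D, |f^n| is smaller than M_D^n(rho) off X_n, so the maximal points form a nonempty
   compact set which, by the strong maximum principle, is open: a contradiction.
   The strict monotonicity of M_D comes from the maximum principle and the identity
   theorem, f being unbounded on D.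

   The strong maximum principle is derived from Goursat's lemma: (F z - F 0) / z has
   an antiderivative G, and along a circle about 0 the derivative of - i G is
   F z - F 0.  The identity theorem is obtained from the maximum principle applied to
   (f - c) / (z - q)^m for all m. *)
Require Import Defs.
From mathcomp Require Import all_boot all_order all_algebra.
From mathcomp Require Import complex.
From mathcomp Require Import all_classical all_reals all_analysis.
From mathcomp Require Import ring lra.
Import Order.TTheory GRing.Theory Num.Theory numFieldNormedType.Exports.
Local Open Scope ring_scope.
Local Open Scope classical_set_scope.

(** * The topology of the complex plane in terms of the real-valued modulus *)

Section Cabs.
Context {R : realType}.
Implicit Types z w : Cx R.

Lemma cabsE z : `|z| = (cabs z)%:C%C.
Proof. by case: z => a b. Qed.

Lemma cabs_ge0 z : 0 <= cabs z.
Proof. by rewrite -ler0c -cabsE. Qed.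

Lemma cabs0 : cabs (0 : Cx R) = 0.
Proof. exact: Normc.normc0. Qed.

Lemma cabs1 : cabs (1 : Cx R) = 1.
Proof. exact: Normc.normc1. Qed.

Lemma cabs_eq0 z : (cabs z == 0) = (z == 0).
Proof. by rewrite -[RHS]normr_eq0 cabsE -(inj_eq (@complexI R)). Qed.

Lemma cabsM z w : cabs (z * w) = cabs z * cabs w.
Proof. exact: Normc.normcM. Qed.

Lemma cabsV z : cabs z^-1 = (cabs z)^-1.
Proof. exact: Normc.normcV. Qed.

Lemma cabsX z n : cabs (z ^+ n) = cabs z ^+ n.
Proof. by elim: n => [|n IH]; rewrite ?expr0 ?cabs1// !exprS cabsM IH. Qed.

Lemma cabsN z : cabs (- z) = cabs z.
Proof. by apply: complexI; rewrite -!cabsE normrN. Qed.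

Lemma cabsB z w : cabs (z - w) = cabs (w - z).
Proof. by rewrite -cabsN opprB. Qed.

Lemma cabsD z w : cabs (z + w) <= cabs z + cabs w.
Proof. exact: le_normcD. Qed.

Lemma cabsBD z u w : cabs (z - w) <= cabs (z - u) + cabs (u - w).
Proof. by rewrite (_ : z - w = (z - u) + (u - w)) ?cabsD// addrA subrK. Qed.

Lemma cabsBl z w : cabs z - cabs w <= cabs (z - w).
Proof. by rewrite lerBlDr -{1}(subrK w z) cabsD. Qed.

Lemma cabsi : cabs ('i%C : Cx R) = 1.
Proof. by rewrite /cabs /= expr0n expr1n add0r sqrtr1. Qed.

Lemma cabs_real (x : R) : cabs (x%:C%C : Cx R) = `|x|.
Proof. by rewrite /cabs /= expr0n addr0 sqrtr_sqr. Qed.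

Lemma sqr_cabs z : cabs z ^+ 2 = complex.Re z ^+ 2 + complex.Im z ^+ 2.
Proof. by case: z => a b; rewrite /cabs /= sqr_sqrtr// addr_ge0// sqr_ge0. Qed.

Lemma Re_cabs z : `|complex.Re z| <= cabs z.
Proof.
rewrite -(@ler_pXn2r _ 2)// ?nnegrE ?cabs_ge0//.
by rewrite sqr_cabs -normrX ger0_norm ?sqr_ge0// lerDl sqr_ge0.
Qed.

Lemma Im_cabs z : `|complex.Im z| <= cabs z.
Proof.
rewrite -(@ler_pXn2r _ 2)// ?nnegrE ?cabs_ge0//.
by rewrite sqr_cabs -normrX ger0_norm ?sqr_ge0// lerDr sqr_ge0.
Qed.

Lemma ReD z w : complex.Re (z + w) = complex.Re z + complex.Re w.
Proof. by case: z; case: w. Qed.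

Lemma ReB z w : complex.Re (z - w) = complex.Re z - complex.Re w.
Proof. by case: z; case: w. Qed.

Lemma ImB z w : complex.Im (z - w) = complex.Im z - complex.Im w.
Proof. by case: z; case: w. Qed.

Lemma cabs_le_ReIm z : cabs z <= `|complex.Re z| + `|complex.Im z|.
Proof.
rewrite -(@ler_pXn2r _ 2)// ?nnegrE ?cabs_ge0 ?addr_ge0//.
rewrite sqr_cabs sqrrD !real_normK ?num_real// lerD2r lerDl.
by rewrite mulrn_wge0// mulr_ge0.
Qed.

(** The norm of [Cx R] is itself complex-valued, so balls have complex radii; a positive complex
    number being real, the radius can be taken in [R]. *)
Lemma nbhs_cxP z (A : set (Cx R)) :
  nbhs z A <-> exists2 e : R, 0 < e & forall w, cabs (w - z) < e -> A w.
Proof.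
split=> [/nbhs_ballP[[a b]]/= | [e e0 eA]].
  rewrite ltcE/= => /andP[/eqP -> a0 zA].
  exists a => // w wz; apply: zA; rewrite -ball_normE/= cabsE.
  by rewrite ltcR cabsB.
apply/nbhs_ballP; exists e%:C%C => /=; first by rewrite ltcR.
by move=> w; rewrite -ball_normE/= cabsE ltcR cabsB; exact: eA.
Qed.

Lemma open_cxP (A : set (Cx R)) : open A <->
  forall z, A z -> exists2 e : R, 0 < e & forall w, cabs (w - z) < e -> A w.
Proof.
by rewrite openE; split=> AP z /AP => [/nbhs_cxP|/nbhs_cxP].
Qed.

Lemma cvg_cxP (F : set_system (Cx R)) (FF : Filter F) (f : Cx R -> Cx R) (l : Cx R) :
  f @ F --> l <-> forall e : R, 0 < e -> F [set w | cabs (f w - l) < e].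
Proof.
split=> [fl e e0|fl A /nbhs_cxP[e e0 eA]].
  by have /fl : nbhs l [set w | cabs (w - l) < e] by apply/nbhs_cxP; exists e.
by apply: (@filterS _ F) (fl _ e0) => w /eA.
Qed.

Lemma continuous_cxP (f : Cx R -> Cx R) z :
  {for z, continuous f} <->
  forall e : R, 0 < e -> exists2 d : R, 0 < d & forall w, cabs (w - z) < d ->
    cabs (f w - f z) < e.
Proof.
split=> [fz e e0|fz].
  by have /cvg_cxP/(_ _ e0)/nbhs_cxP := fz.
move=> A /nbhs_cxP[e e0 eA]; have [d d0 dP] := fz _ e0.
by apply/nbhs_cxP; exists d => // w /dP /eA.
Qed.

Lemma cabs_continuous : continuous (@cabs R).
Proof.
move=> z A /nbhs_ballP[e e0 eA]; apply/nbhs_cxP; exists e => // w wz.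
apply: eA; rewrite -ball_normE/= ltr_norml; have := cabsBl z w; have := cabsBl w z.
by rewrite (cabsB z w) => ? ?; apply/andP; split; lra.
Qed.

Lemma Complex_continuous : continuous (fun p : R * R => Complex p.1 p.2 : Cx R).
Proof.
move=> [a b] A /nbhs_cxP[e e0 eA].
have e2 : 0 < e / 2 by rewrite divr_gt0.
apply/nbhs_ballP; exists (e / 2) => // -[c d] [] /=.
rewrite -!ball_normE/= => ac bd; apply: eA.
apply: le_lt_trans (cabs_le_ReIm _) _ => /=.
by rewrite (distrC c) (distrC d); lra.
Qed.

Lemma compact_cabs_le (r : R) : compact [set z : Cx R | cabs z <= r].
Proof.
pose Q := (fun p : R * R => Complex p.1 p.2 : Cx R) @` (`[- r, r] `*` `[- r, r]).
have cQ : compact Q.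
  apply: continuous_compact; last by apply: compact_setX; exact: segment_compact.
  exact/continuous_subspaceT/Complex_continuous.
have -> : [set z : Cx R | cabs z <= r] = Q `&` [set z : Cx R | cabs z <= r].
  rewrite setIidr// => -[a b] /= abr; exists (a, b) => //=.
  have /= := Re_cabs (Complex a b); have /= := Im_cabs (Complex a b).
  by rewrite !in_itv/= -!ler_norml; split; apply: le_trans abr.
apply: compact_closedI cQ _.
apply: (@preimage_closed _ _ (@cabs R) [set x | x <= r]); last exact: closed_le.
by move=> z _; exact: cabs_continuous.
Qed.

Lemma hausdorff_cx : hausdorff_space (Cx R).
Proof. exact: norm_hausdorff. Qed.

Lemma compact_cxP (A : set (Cx R)) (r : R) :
  closed A -> (forall z, A z -> cabs z <= r) -> compact A.
Proof.
move=> cA Ar; have -> : A = [set z : Cx R | cabs z <= r] `&` A.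
  by rewrite setIidr.
exact: compact_closedI (@compact_cabs_le r) cA.
Qed.

(** Clearing the denominator gives a remainder estimate that also covers [w = z] and can be
    integrated along curves. *)
Lemma derivable_cxP (f : Cx R -> Cx R) z :
  derivable f z 1 <-> exists l : Cx R, forall e : R, 0 < e ->
    exists2 d : R, 0 < d & forall w, cabs (w - z) < d ->
      cabs (f w - f z - l * (w - z)) <= e * cabs (w - z).
Proof.
split=> [/cvg_ex[l fl]|[l fl]].
  exists l => e e0; move/cvg_cxP/(_ _ e0) : fl.
  rewrite /dnbhs /within /= => /nbhs_cxP[d d0 dP]; exists d => // w wz.
  have [->|wnz] := eqVneq w z; first by rewrite !subrr mulr0 subr0 cabs0 mulr0.
  have := dP (w - z); rewrite subr0 subr_eq0 => /(_ wz wnz).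
  rewrite scaler1 subrK => /ltW h.
  have nz : w - z != 0 by rewrite subr_eq0.
  rewrite -[X in cabs (X - _)](mulVKf nz) (mulrC l) -mulrBr cabsM mulrC.
  by rewrite ler_wpM2r// cabs_ge0.
apply/cvg_ex; exists l; apply/cvg_cxP => e e0.
have e2 : 0 < e / 2 by rewrite divr_gt0.
have [d d0 dP] := fl _ e2.
rewrite /dnbhs /within /=; apply/nbhs_cxP; exists d => // h; rewrite subr0 => hd h0.
have := dP (h + z); rewrite addrK => /(_ hd).
rewrite scaler1 /GRing.scale/= => H.
have ch : 0 < cabs h by rewrite lt_neqAle cabs_ge0 andbT eq_sym cabs_eq0.
have -> : h^-1 * (f (h + z) - f z) - l = h^-1 * (f (h + z) - f z - l * h).
  by rewrite [RHS]mulrBr (mulrC l) (mulKf h0 l).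
rewrite cabsM cabsV mulrC ltr_pdivrMr//; apply: le_lt_trans H _.
by rewrite ltr_pM2r// ltr_pdivrMr// ltr_pMr// ltr1n.
Qed.

Lemma derivable_cx_continuous (f : Cx R -> Cx R) z :
  derivable f z 1 -> {for z, continuous f}.
Proof. by move=> /derivable1_diffP/differentiable_continuous. Qed.

End Cabs.

(** * Primitives of continuous functions and vanishing by bisection *)

Section Primitive.
Context {R : realType}.

(* All integrals are taken inside the square |Re z| < 1, |Im z| < 1, the integrands
   being continuous on the larger square |Re z| < 2, |Im z| < 2. *)
Lemma continuous_primitive (phi : R -> R) :
  (forall t : R, -2 < t < 2 -> {for t, continuous phi}) ->
  exists F : R -> R, forall x : R, -1 < x < 1 -> is_derive x 1 F (phi x).
Proof.
move=> cphi; exists (fun x => \int[lebesgue_measure]_(t in `[-1, x]) phi t)%R.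
move=> x /andP[x1 x2].
have cI : {within `[-1, 1], continuous phi}.
  apply: continuous_in_subspaceT => t /set_mem/=; rewrite in_itv/= => /andP[t1 t2].
  by apply: cphi; apply/andP; split; lra.
have iI : lebesgue_measure.-integrable `[-1, 1] (EFin \o phi).
  by apply: continuous_compact_integrable cI; exact: segment_compact.
have x3 : -2 < x < 2 by apply/andP; split; lra.
have [dF F'] := continuous_FTC1_closed x2 iI x1 (cphi x x3).
rewrite derive1E in F'.
exact (DeriveDef dF F').
Qed.

(** The values are determined only inside (-1, 1) and up to a constant, so only differences carry
    meaning; [cst 0] is the default when no primitive exists. *)
Definition primitive (phi : R -> R) : R -> R :=
  xget (cst 0) [set F | forall x : R, -1 < x < 1 -> is_derive x 1 F (phi x)].

Lemma primitiveP (phi : R -> R) (x : R) :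
  (forall t : R, -2 < t < 2 -> {for t, continuous phi}) -> -1 < x < 1 ->
  is_derive x 1 (primitive phi) (phi x).
Proof.
move=> /continuous_primitive[F HF] x1.
rewrite /primitive.
by have := @xgetPex _ (cst 0)
  [set F | forall x : R, -1 < x < 1 -> is_derive x 1 F (phi x)] (ex_intro _ _ HF) _ x1.
Qed.

(** The mean value theorem, applied to the primitive minus a quadratic primitive of
    [al + be * t]. *)
Lemma primitive_approx_le (phi : R -> R) (a b al be e : R) :
  (forall t : R, -2 < t < 2 -> {for t, continuous phi}) ->
  -1 < a -> a <= b -> b < 1 ->
  (forall t, a <= t <= b -> `|phi t - (al + be * t)| <= e) ->
  `|primitive phi b - primitive phi a -
    (al * (b - a) + be * ((b ^+ 2 - a ^+ 2) / 2))| <= e * (b - a).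
Proof.
move=> cphi a1 ab b1 He.
pose F t := primitive phi t - (al * t + be / 2 * t ^+ 2).
have dF (t : R) : -1 < t < 1 -> is_derive t 1 F (phi t - (al + be * t)).
  move=> t1; have dp := primitiveP phi t cphi t1.
  rewrite /F; apply: is_deriveB; apply: is_derive_eq.
  by rewrite /GRing.scale/=; lra.
have [] := @MVT_segment R F (fun t => phi t - (al + be * t)) a b ab.
- by move=> t; rewrite in_itv/= => /andP[t1 t2]; apply: dF; apply/andP; split; lra.
- apply: derivable_within_continuous => t; rewrite in_itv/= => /andP[t1 t2].
  by have [] := dF t; [apply/andP; split; lra|].
move=> t; rewrite in_itv/= => tab Ft.
have -> : primitive phi b - primitive phi a -
  (al * (b - a) + be * ((b ^+ 2 - a ^+ 2) / 2)) = F b - F a by rewrite /F; lra.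
by rewrite Ft normrM (ger0_norm (_ : 0 <= b - a)) ?subr_ge0// ler_wpM2r ?subr_ge0// He.
Qed.

(** As a difference of primitives, the integral is additive and changes sign with the orientation by
    pure algebra, for all endpoints. *)
Definition cint (phi : R -> Cx R) (a b : R) : Cx R :=
  Complex (primitive (fun t => complex.Re (phi t)) b -
           primitive (fun t => complex.Re (phi t)) a)
          (primitive (fun t => complex.Im (phi t)) b -
           primitive (fun t => complex.Im (phi t)) a).

Lemma cint_cat (phi : R -> Cx R) a b c : cint phi a c = cint phi a b + cint phi b c.
Proof. by apply/eqP; rewrite eq_complex/=; apply/andP; split; apply/eqP; ring. Qed.

Lemma cintxx (phi : R -> Cx R) a : cint phi a a = 0.
Proof. by rewrite /cint !subrr. Qed.

Lemma cintC (phi : R -> Cx R) a b : cint phi b a = - cint phi a b.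
Proof. by apply/eqP; rewrite -addr_eq0 -cint_cat cintxx. Qed.

Definition curve_continuous (phi : R -> Cx R) := forall t, -2 < t < 2 ->
  {for t, continuous (fun t => complex.Re (phi t))} /\
  {for t, continuous (fun t => complex.Im (phi t))}.

(** Real and imaginary parts are estimated separately, hence the factor 2. The interval of the [t]
    considered is centred at [a], so it contains the segment for either order of the endpoints. *)
Lemma cint_approx (phi : R -> Cx R) (a b : R) (A B : Cx R) (e : R) :
  curve_continuous phi -> -1 < a < 1 -> -1 < b < 1 ->
  (forall t, `|t - a| <= `|b - a| -> cabs (phi t - (A + B * t%:C%C)) <= e) ->
  cabs (cint phi a b - (A * (b - a)%:C%C + B * ((b ^+ 2 - a ^+ 2) / 2)%:C%C))
    <= 2 * e * `|b - a|.
Proof.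
move=> cphi.
have [cr ci] : (forall t : R, -2 < t < 2 -> {for t, continuous (fun t => complex.Re (phi t))}) /\
  (forall t : R, -2 < t < 2 -> {for t, continuous (fun t => complex.Im (phi t))}).
  by split=> t /cphi[].
have main (x y : R) : -1 < x -> x <= y -> y < 1 ->
    (forall t, x <= t <= y -> cabs (phi t - (A + B * t%:C%C)) <= e) ->
    cabs (cint phi x y - (A * (y - x)%:C%C + B * ((y ^+ 2 - x ^+ 2) / 2)%:C%C))
    <= 2 * e * (y - x).
  move=> x1 xy y1 H.
  have H1 := primitive_approx_le _ _ _ (complex.Re A) (complex.Re B) e cr x1 xy y1.
  have H2 := primitive_approx_le _ _ _ (complex.Im A) (complex.Im B) e ci x1 xy y1.
  apply: le_trans (cabs_le_ReIm _) _.
  have -> : 2 * e * (y - x) = e * (y - x) + e * (y - x) by ring.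
  case: A B H H1 H2 => [A1 A2] [B1 B2] H H1 H2.
  apply: lerD => /=.
    rewrite !mulr0 !subr0; apply: H1 => t /H; apply: le_trans.
    by apply: le_trans (Re_cabs _); case: (phi t) => ? ? /=; rewrite mulr0 subr0.
  rewrite !mulr0 !add0r; apply: H2 => t /H; apply: le_trans.
  by apply: le_trans (Im_cabs _); case: (phi t) => ? ? /=; rewrite mulr0 add0r.
move=> /andP[a1 a2] /andP[b1 b2] H.
have [ab|ba] := leP a b.
  rewrite ger0_norm ?subr_ge0//; apply: main => // t /andP[t1 t2]; apply: H.
  by rewrite !ger0_norm ?subr_ge0//; lra.
have := main b a b1 (ltW ba) a2; rewrite cintC.
rewrite ltr0_norm ?subr_lt0// opprB => Hm.
apply: le_trans (Hm _).
  rewrite -cabsN le_eqVlt; apply/orP; left; apply/eqP; congr cabs.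
  have -> : (a - b)%:C%C = - (b - a)%:C%C :> Cx R.
    by rewrite -rmorphN opprB.
  have -> : ((a ^+ 2 - b ^+ 2) / 2)%:C%C = - ((b ^+ 2 - a ^+ 2) / 2)%:C%C :> Cx R.
    by rewrite -[RHS]rmorphN; congr (_%:C%C); lra.
  by ring.
move=> t /andP[t1 t2]; apply: H.
by rewrite ler0_norm ?subr_le0// ler0_norm ?subr_le0 ?(ltW ba)//; lra.
Qed.

(** Left ends increase, right ends decrease, and each left end is below each right end: the supremum
    of the left ends works. *)
Lemma nested_halves (a : nat -> R) (w : R) : 0 <= w ->
  (forall n, a n.+1 = a n \/ a n.+1 = a n + w / 2 ^+ n.+1) ->
  exists p, forall n, a n <= p <= a n + w / 2 ^+ n.
Proof.
move=> w0 ha.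
have w2 n : 0 <= w / 2 ^+ n.+1 by rewrite divr_ge0// exprn_ge0.
have half n : w / 2 ^+ n = w / 2 ^+ n.+1 + w / 2 ^+ n.+1.
  rewrite exprS; have : (2 : R) ^+ n != 0 by rewrite expf_neq0.
  by move=> ?; field.
have na : {homo a : n m / (n <= m)%N >-> n <= m}.
  apply/nondecreasing_seqP => n; have := w2 n.
  by case: (ha n) => ->; lra.
have nb : {homo (fun n => a n + w / 2 ^+ n) : n m / (n <= m)%N >-> m <= n}.
  apply/nonincreasing_seqP => n; have := w2 n; rewrite (half n).
  by case: (ha n) => ->; lra.
have ab n m : a n <= a m + w / 2 ^+ m.
  apply: (le_trans (na _ _ (leq_maxl n m))).
  apply: le_trans (nb _ _ (leq_maxr n m)).
  by rewrite lerDl divr_ge0// exprn_ge0.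
exists (sup (range a)) => n; apply/andP; split.
  by apply: ub_le_sup; [exists (a 0%N + w / 2 ^+ 0) => _ [m _ <-]|exists n].
by apply: ge_sup; [exists (a 0%N), 0%N|move=> _ [m _ <-]].
Qed.

(** Goursat's subdivision for an abstract additive function of rectangles: some quarter always keeps
    a quarter of the modulus, while around the common point of the nested rectangles the modulus is
    an arbitrarily small multiple of the squared size. *)
Lemma bisect_vanish (J : R -> R -> R -> R -> Cx R) (a b c d : R) :
  a <= b -> c <= d ->
  (forall a b m c d, J a b c d = J a m c d + J m b c d) ->
  (forall a b c m d, J a b c d = J a b c m + J a b m d) ->
  (forall p q, a <= p <= b -> c <= q <= d -> forall e : R, 0 < e ->
    exists2 r : R, 0 < r & forall a' b' c' d', a' <= p <= b' -> c' <= q <= d' ->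
      a <= a' -> b' <= b -> c <= c' -> d' <= d -> b' - a' < r -> d' - c' < r ->
      cabs (J a' b' c' d') <= e * ((b' - a') + (d' - c')) ^+ 2) ->
  J a b c d = 0.
Proof.
move=> ab cd Jx Jy Jsmall; apply/eqP; rewrite -cabs_eq0; apply: contraT => J0.
set w := b - a; set h := d - c; set eta := cabs (J a b c d) in J0.
have eta0 : 0 < eta by rewrite lt_neqAle eq_sym J0 cabs_ge0.
have w0 : 0 <= w by rewrite subr_ge0.
have h0 : 0 <= h by rewrite subr_ge0.
pose K n (u : R * R) := J u.1 (u.1 + w / 2 ^+ n) u.2 (u.2 + h / 2 ^+ n).
have stepP (nu : nat * (R * R)) : exists v : R * R,
    (v.1 = nu.2.1 \/ v.1 = nu.2.1 + w / 2 ^+ nu.1.+1) /\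
    (v.2 = nu.2.2 \/ v.2 = nu.2.2 + h / 2 ^+ nu.1.+1) /\
    cabs (K nu.1 nu.2) <= 4 * cabs (K nu.1.+1 v).
  case: nu => n [x y] /=.
  set w' := w / 2 ^+ n.+1; set h' := h / 2 ^+ n.+1.
  have n2 : (2 : R) ^+ n != 0 by rewrite expf_neq0.
  have wE : w / 2 ^+ n = w' + w' by rewrite /w' exprS; field.
  have hE : h / 2 ^+ n = h' + h' by rewrite /h' exprS; field.
  have KE : K n (x, y) = K n.+1 (x, y) + K n.+1 (x, y + h') +
      (K n.+1 (x + w', y) + K n.+1 (x + w', y + h')).
    rewrite /K /= wE hE -/w' -/h' !addrA.
    by rewrite (Jx x _ (x + w')) (Jy x _ _ (y + h')) (Jy (x + w') _ _ (y + h')) !addrA.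
  have [k1|k1] := leP (cabs (K n (x, y))) (4 * cabs (K n.+1 (x, y))).
    by exists (x, y); split; [left|split; [left|]].
  have [k2|k2] := leP (cabs (K n (x, y))) (4 * cabs (K n.+1 (x, y + h'))).
    by exists (x, y + h'); split; [left|split; [right|]].
  have [k3|k3] := leP (cabs (K n (x, y))) (4 * cabs (K n.+1 (x + w', y))).
    by exists (x + w', y); split; [right|split; [left|]].
  (* If the other three quarters each hold less than a quarter of the modulus, the triangle
     inequality leaves at least that much to the fourth. *)
  exists (x + w', y + h'); split; [by right|split; [by right|]].
  move: k1 k2 k3; rewrite {1 2 3 4}KE.
  have := cabsD (K n.+1 (x, y) + K n.+1 (x, y + h'))
    (K n.+1 (x + w', y) + K n.+1 (x + w', y + h')).
  have := cabsD (K n.+1 (x, y)) (K n.+1 (x, y + h')).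
  have := cabsD (K n.+1 (x + w', y)) (K n.+1 (x + w', y + h')).
  by lra.
have [step HS] := choice stepP.
pose u := fix u n := if n is m.+1 then step (m, u m) else (a, c).
have uS n : u n.+1 = step (n, u n) by [].
have Ku n : eta / 4 ^+ n <= cabs (K n (u n)).
  elim: n => [|n IH].
    by rewrite /K /= expr0 !divr1 /w /h addrC subrK addrC subrK.
  rewrite uS; have [_ [_ /=]] := HS (n, u n) => H.
  rewrite exprS invfM mulrCA -ler_pdivlMl ?invr_gt0// invrK mulrC.
  by rewrite mulrC; exact: le_trans IH H.
have [p hp] := nested_halves (fun n => (u n).1) w w0 (fun n => (HS (n, u n)).1).
have [q hq] := nested_halves (fun n => (u n).2) h h0 (fun n => (HS (n, u n)).2.1).
have half x n : x / 2 ^+ n = x / 2 ^+ n.+1 + x / 2 ^+ n.+1 :> R.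
  rewrite exprS; have : (2 : R) ^+ n != 0 by rewrite expf_neq0.
  by move=> ?; field.
have ina n : a <= (u n).1 /\ (u n).1 + w / 2 ^+ n <= b.
  elim: n => [|n [IH1 IH2]]; first by rewrite /= expr0 divr1 /w; split=> //; lra.
  have w2 : 0 <= w / 2 ^+ n.+1 by rewrite divr_ge0// exprn_ge0.
  rewrite half in IH2; have [+ _] := HS (n, u n); rewrite -uS /=.
  by case=> ->; split; lra.
have inc n : c <= (u n).2 /\ (u n).2 + h / 2 ^+ n <= d.
  elim: n => [|n [IH1 IH2]]; first by rewrite /= expr0 divr1 /h; split=> //; lra.
  have w2 : 0 <= h / 2 ^+ n.+1 by rewrite divr_ge0// exprn_ge0.
  rewrite half in IH2; have [_ [+ _]] := HS (n, u n); rewrite -uS /=.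
  by case=> ->; split; lra.
have hp0 := hp 0%N; have hq0 := hq 0%N.
rewrite /= expr0 divr1 /w in hp0; rewrite /= expr0 divr1 /h in hq0.
have pab : a <= p <= b by move: hp0 => /andP[? ?]; apply/andP; split; lra.
have qcd : c <= q <= d by move: hq0 => /andP[? ?]; apply/andP; split; lra.
have s0 : 0 < (w + h) ^+ 2 + 1 by rewrite ltr_wpDl// sqr_ge0.
(* Both bounds scale like the inverse of [4 ^+ n], and this tolerance makes [eta] at most half of
   itself; the added 1 keeps the denominator positive for a degenerate rectangle. *)
have t0 : 0 < eta / ((w + h) ^+ 2 + 1) / 2 by rewrite !divr_gt0.
have [r r0 rP] := Jsmall p q pab qcd _ t0.
have [n nr] : exists n, (w + h) / 2 ^+ n < r.
  have : (fun n => (w + h) / 2 ^+ n) @ \oo --> ((w + h) * 0 : R).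
    apply: cvgMr; under eq_fun do rewrite -exprVn.
    by apply: cvg_expr; rewrite ger0_norm ?invr_ge0// invf_lt1// ltr1n.
  rewrite mulr0 => /cvgrPdist_lt/(_ r r0)[n _ /(_ n (leqnn _))].
  have wh0 : 0 <= (w + h) / 2 ^+ n by rewrite divr_ge0 ?exprn_ge0//; exact: addr_ge0.
  by rewrite /= sub0r normrN ger0_norm// => ?; exists n.
have wn0 : 0 <= w / 2 ^+ n by rewrite divr_ge0// exprn_ge0.
have hn0 : 0 <= h / 2 ^+ n by rewrite divr_ge0// exprn_ge0.
rewrite mulrDl in nr.
have := rP (u n).1 ((u n).1 + w / 2 ^+ n) (u n).2 ((u n).2 + h / 2 ^+ n)
  (hp n) (hq n) (ina n).1 (ina n).2 (inc n).1 (inc n).2.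
rewrite !(addrC (u n).1) !(addrC (u n).2) !addrK => /(_ ltac:(lra) ltac:(lra)).
move: (Ku n); rewrite /K !(addrC (u n).1) !(addrC (u n).2) => H1 H2.
have := le_trans H1 H2; rewrite -mulrDl.
have -> : (4 : R) ^+ n = (2 ^+ n) ^+ 2 by rewrite -exprM mulnC exprM; congr (_ ^+ _); ring.
rewrite expr_div_n mulrA ler_pM2r ?invr_gt0 ?exprn_gt0//.
have X0 := sqr_ge0 (w + h); set X := (w + h) ^+ 2 in X0 s0 * => H3.
have t1 : 0 < eta / (X + 1) by exact: divr_gt0.
have tE : eta = eta / (X + 1) * (X + 1) by rewrite divfK// gt_eqF.
move: H3; rewrite {1}tE; have := mulr_ge0 (ltW t1) X0.
by lra.
Qed.

End Primitive.

(** * Goursat's lemma and antiderivatives *)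

Section Goursat.
Context {R : realType}.
Implicit Types g : Cx R -> Cx R.

Definition in_square (r : R) : set (Cx R) :=
  [set z | `|complex.Re z| < r /\ `|complex.Im z| < r].

Lemma curve_continuous_lipschitz g (gamma : R -> Cx R) :
  (forall z, in_square 2 z -> {for z, continuous g}) ->
  (forall t, -2 < t < 2 -> in_square 2 (gamma t)) ->
  (forall s t, cabs (gamma s - gamma t) <= `|s - t|) ->
  curve_continuous (fun t => g (gamma t)).
Proof.
move=> cg sq lip t t2; have /continuous_cxP gt := cg _ (sq _ t2).
split=> A /nbhs_ballP[e /= e0 eA]; have [d d0 dP] := gt _ e0;
  apply/nbhs_ballP; exists d => // s; rewrite -ball_normE/= distrC => st;
  apply: eA; rewrite -ball_normE/= distrC -?ReB -?ImB.
  exact: le_lt_trans (Re_cabs _) (dP _ (le_lt_trans (lip _ _) st)).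
exact: le_lt_trans (Im_cabs _) (dP _ (le_lt_trans (lip _ _) st)).
Qed.

Lemma horizontal_continuous g (y : R) : -1 < y < 1 ->
  (forall z, in_square 2 z -> {for z, continuous g}) ->
  curve_continuous (fun t => g (Complex t y)).
Proof.
move=> /andP[y1 y2] cg; apply: curve_continuous_lipschitz => // [t /andP[t1 t2]|s t].
  by split=> /=; rewrite ltr_norml; apply/andP; split; lra.
by apply: le_trans (cabs_le_ReIm _) _; rewrite /= subrr normr0 addr0.
Qed.

Lemma vertical_continuous g (x : R) : -1 < x < 1 ->
  (forall z, in_square 2 z -> {for z, continuous g}) ->
  curve_continuous (fun t => g (Complex x t)).
Proof.
move=> /andP[x1 x2] cg; apply: curve_continuous_lipschitz => // [t /andP[t1 t2]|s t].
  by split=> /=; rewrite ltr_norml; apply/andP; split; lra.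
by apply: le_trans (cabs_le_ReIm _) _; rewrite /= subrr normr0 add0r.
Qed.

(** For [a <= b] and [c <= d], the counterclockwise boundary integral: bottom minus top, plus i
    times right minus left. *)
Definition rect_int g (a b c d : R) : Cx R :=
  cint (fun t => g (Complex t c)) a b - cint (fun t => g (Complex t d)) a b +
  'i%C * (cint (fun t => g (Complex b t)) c d - cint (fun t => g (Complex a t)) c d).

Lemma rect_int_catx g a b m c d :
  rect_int g a b c d = rect_int g a m c d + rect_int g m b c d.
Proof. by rewrite /rect_int !(cint_cat _ a m b); ring. Qed.

Lemma rect_int_caty g a b c m d :
  rect_int g a b c d = rect_int g a b c m + rect_int g a b m d.
Proof. by rewrite /rect_int !(cint_cat _ c m d); ring. Qed.

Lemma rect_intCx g a b c d : rect_int g b a c d = - rect_int g a b c d.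
Proof. by rewrite /rect_int !(cintC _ a b); ring. Qed.

Lemma rect_intCy g a b c d : rect_int g a b d c = - rect_int g a b c d.
Proof. by rewrite /rect_int !(cintC _ c d); ring. Qed.

(** The boundary integral of an affine function is zero, so only the errors on the four sides
    remain. *)
Lemma rect_int_approx g (a b c d : R) (A B : Cx R) (e : R) :
  (forall z, in_square 2 z -> {for z, continuous g}) ->
  -1 < a < 1 -> -1 < b < 1 -> -1 < c < 1 -> -1 < d < 1 ->
  (forall z, `|complex.Re z - a| <= `|b - a| -> `|complex.Im z - c| <= `|d - c| ->
    cabs (g z - (A + B * z)) <= e) ->
  cabs (rect_int g a b c d) <= 4 * e * (`|b - a| + `|d - c|).
Proof.
move=> cg a1 b1 c1 d1 H.
have Cxy (x y : R) : Complex x y = x%:C%C + 'i%C * y%:C%C :> Cx R.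
  exact: (complexE (Complex x y)).
have hor y : -1 < y < 1 -> `|y - c| <= `|d - c| ->
    cabs (cint (fun t => g (Complex t y)) a b - ((A + B * ('i%C * y%:C%C)) * (b - a)%:C%C
      + B * ((b ^+ 2 - a ^+ 2) / 2)%:C%C)) <= 2 * e * `|b - a|.
  move=> y1 yc; apply: cint_approx => //; first exact: horizontal_continuous.
  move=> t ta; have := H (Complex t y) ta yc.
  suff -> : A + B * ('i%C * y%:C%C) + B * t%:C%C = A + B * (Complex t y) by [].
  by rewrite (Cxy t y); ring.
have ver x : -1 < x < 1 -> `|x - a| <= `|b - a| ->
    cabs (cint (fun t => g (Complex x t)) c d - ((A + B * x%:C%C) * (d - c)%:C%C
      + B * 'i%C * ((d ^+ 2 - c ^+ 2) / 2)%:C%C)) <= 2 * e * `|d - c|.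
  move=> x1 xc; apply: cint_approx => //; first exact: vertical_continuous.
  move=> t tc; have := H (Complex x t) xc tc.
  suff -> : A + B * x%:C%C + B * 'i%C * t%:C%C = A + B * (Complex x t) by [].
  by rewrite (Cxy x t); ring.
have := hor c c1; rewrite subrr normr0 => /(_ (normr_ge0 _)).
have := hor d d1 (lexx _).
have := ver a a1; rewrite subrr normr0 => /(_ (normr_ge0 _)).
have := ver b b1 (lexx _).
rewrite /rect_int.
set V2 := cint _ _ _; set P2 := _ + B * 'i%C * _ => h1.
set V1 := cint _ _ _; set P1 := _ + B * 'i%C * _ => h2.
set H2 := cint _ _ _; set Q2 := (_ + _) * _ + _ => h3.
set H1 := cint _ _ _; set Q1 := (_ + _) * _ + _ => h4.
have -> : H1 - H2 + 'i%C * (V2 - V1) =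
    (H1 - Q1) - (H2 - Q2) + 'i%C * ((V2 - P2) - (V1 - P1)).
  (* [Q1], [Q2], [P1], [P2] are the exact integrals of [A + B * z], in the real parameter, over the
     bottom, top, left and right sides. *)
  suff : Q1 - Q2 + 'i%C * (P2 - P1) = 0 by move=> E; rewrite -[LHS]subr0 -E; ring.
  rewrite /Q1 /Q2 /P1 /P2 !rmorphB; ring.
apply: le_trans (cabsD _ _) _; rewrite cabsM cabsi mul1r.
have := cabsD (H1 - Q1) (- (H2 - Q2)); rewrite (cabsN (H2 - Q2)).
have := cabsD (V2 - P2) (- (V1 - P1)); rewrite (cabsN (V1 - P1)).
by lra.
Qed.

(** The affine approximation at a point has error [e] times the size of the rectangle, up to
    constants; integrated over the boundary this gives [e] times the squared size, as the bisection
    requires. *)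
Lemma goursat g (a b c d : R) :
  (forall z, in_square 2 z -> {for z, continuous g}) ->
  -1 < a -> a <= b -> b < 1 -> -1 < c -> c <= d -> d < 1 ->
  (forall z, a <= complex.Re z <= b -> c <= complex.Im z <= d -> derivable g z 1) ->
  rect_int g a b c d = 0.
Proof.
move=> cg a1 ab b1 c1 cd d1 dg; apply: bisect_vanish => //.
- exact: rect_int_catx.
- exact: rect_int_caty.
move=> p q pab qcd e e0.
have /derivable_cxP[l dgl] := dg (Complex p q) pab qcd.
have e8 : 0 < e / 8 by rewrite divr_gt0.
have [r r0 rP] := dgl _ e8.
(* The region tested by [rect_int_approx] is centred at the corner [(a', c')], so its points lie
   within [2 * s] of [(p, q)]; here [s < r / 2]. *)
exists (r / 4); first by rewrite divr_gt0.
move=> a' b' c' d' /andP[p1 p2] /andP[q1 q2] aa bb cc dd ab' cd'.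
set s := b' - a' + (d' - c').
have -> : e * s ^+ 2 = 4 * (e / 8 * (2 * s)) * s by field.
have nb : `|b' - a'| = b' - a' by rewrite ger0_norm//; lra.
have nd : `|d' - c'| = d' - c' by rewrite ger0_norm//; lra.
have := @rect_int_approx g a' b' c' d' (g (Complex p q) - l * Complex p q) l
  (e / 8 * (2 * s)) cg.
rewrite nb nd; apply; try by apply/andP; split; lra.
move=> z; rewrite !ler_norml => /andP[z1 z2] /andP[z3 z4].
have zp : cabs (z - Complex p q) <= 2 * s.
  apply: le_trans (cabs_le_ReIm _) _; rewrite ReB ImB /= /s.
  have h1 : `|complex.Re z - p| <= 2 * (b' - a').
    by rewrite ler_norml; apply/andP; split; lra.
  have h2 : `|complex.Im z - q| <= 2 * (d' - c').
    by rewrite ler_norml; apply/andP; split; lra.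
  by lra.
have -> : g z - (g (Complex p q) - l * Complex p q + l * z) =
  g z - g (Complex p q) - l * (z - Complex p q) by ring.
apply: le_trans (rP _ _) _; first by rewrite /s in zp; lra.
by rewrite ler_wpM2l// ltW.
Qed.

(** The sign condition keeps 0 out of the rectangle; swapping endpoints only changes the sign of the
    integral. *)
Lemma goursat_off0 g (a b c d : R) :
  (forall z, in_square 2 z -> {for z, continuous g}) ->
  (forall z, in_square 1 z -> z != 0 -> derivable g z 1) ->
  -1 < a < 1 -> -1 < b < 1 -> -1 < c < 1 -> -1 < d < 1 -> 0 < a * b \/ 0 < c * d ->
  rect_int g a b c d = 0.
Proof.
move=> cg dg.
have main (a' b' c' d' : R) : a' <= b' -> c' <= d' ->
    -1 < a' < 1 -> -1 < b' < 1 -> -1 < c' < 1 -> -1 < d' < 1 ->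
    0 < a' * b' \/ 0 < c' * d' -> rect_int g a' b' c' d' = 0.
  move=> ab cd /andP[a1 a2] /andP[b1 b2] /andP[c1 c2] /andP[d1 d2] nz.
  apply: goursat => // z /andP[z1 z2] /andP[z3 z4]; apply: dg.
    by split; rewrite ltr_norml; apply/andP; split; lra.
  apply/eqP => z0; rewrite z0 /= in z1 z2 z3 z4.
  by case: nz; apply/negP; rewrite -leNgt; nra.
move=> a1 b1 c1 d1 nz.
have [ab|/ltW ab] := leP a b; have [cd|/ltW cd] := leP c d.
- exact: main.
- by rewrite rect_intCy main ?oppr0// (mulrC d).
- by rewrite rect_intCx main ?oppr0// (mulrC b).
- by rewrite rect_intCy rect_intCx main ?oppr0// (mulrC b) (mulrC d).
Qed.

(** Cutting off the corner rectangle scaled by [t] leaves pieces that avoid 0; the integral over the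
    corner piece tends to 0 with [t], because [g] is bounded near 0. *)
Lemma goursat_corner g (x y : R) :
  (forall z, in_square 2 z -> {for z, continuous g}) ->
  (forall z, in_square 1 z -> z != 0 -> derivable g z 1) ->
  -1 < x < 1 -> -1 < y < 1 -> rect_int g 0 x 0 y = 0.
Proof.
move=> cg dg x1 y1.
have o1 : -1 < (0 : R) < 1 by apply/andP; split; lra.
have [->|x0] := eqVneq x 0; first by rewrite /rect_int !cintxx; ring.
have [->|y0] := eqVneq y 0; first by rewrite /rect_int !cintxx; ring.
have [|d d0 dP] := (continuous_cxP g 0).1 (cg 0 _) 1 ltr01.
  by split; rewrite /= normr0.
pose M := cabs (g 0) + 1.
have M0 : 0 < M by rewrite ltr_wpDl// cabs_ge0.
apply/eqP; rewrite -cabs_eq0; apply/eqP/le_anti; rewrite cabs_ge0 andbT.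
apply/ler_addgt0Pr => e e0; rewrite add0r.
have xy0 : 0 <= `|x| + `|y| by rewrite addr_ge0.
(* The three bounds keep the scaled corner in the unit square, put the points tested within [d] of
   0, and make the final error at most [e]. *)
have t0 : 0 < Num.min (1 / 2) (Num.min (d / 4) (e / (4 * M * 2))).
  by rewrite !lt_min !divr_gt0// !mulr_gt0.
set t := Num.min _ _ in t0.
have [th [td te]] : t <= 1 / 2 /\ t <= d / 4 /\ t <= e / (4 * M * 2).
  by rewrite /t !ge_min !lexx !orbT.
have sub (u : R) : -1 < u < 1 -> -1 < t * u < 1.
  by move=> /andP[u1 u2]; apply/andP; split; nra.
have pos (u : R) : u != 0 -> 0 < t * u * u.
  by move=> u0; rewrite -mulrA mulr_gt0// lt_neqAle eq_sym mulf_neq0//= -expr2 sqr_ge0.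
rewrite (rect_int_catx _ 0 x (t * x)) (rect_int_caty _ 0 (t * x) 0 (t * y)).
rewrite (goursat_off0 g (t * x) x) //; [|exact: sub|by left; exact: pos].
rewrite (goursat_off0 g 0 (t * x) (t * y)) //;
  [|exact: sub|exact: sub|by right; exact: pos].
rewrite !addr0.
have := @rect_int_approx g 0 (t * x) 0 (t * y) 0 0 M cg o1 (sub _ x1) o1 (sub _ y1).
rewrite !subr0 !normrM (gtr0_norm t0).
have nx : `|x| < 1 by rewrite ltr_norml.
have ny : `|y| < 1 by rewrite ltr_norml.
move=> /(_ _)/le_trans; apply.
  move=> z; rewrite !subr0 => zx zy; rewrite add0r mul0r subr0.
  have zd : cabs (z - 0) < d.
    by rewrite subr0; apply: le_lt_trans (cabs_le_ReIm _) _; nra.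
  by have := dP _ zd; have := cabsBl (g z) (g 0); rewrite /M; lra.
have -> : e = 4 * M * 2 * (e / (4 * M * 2)) by field; rewrite gt_eqF.
rewrite -[leRHS]mulrA ler_wpM2l ?mulr_ge0// ?(ltW M0)//.
apply: le_trans (_ : 2 * t <= _); last by rewrite ler_wpM2l.
by nra.
Qed.

(** [G] integrates from 0 along the real axis, then vertically. Two rectangles with a corner at 0
    turn [G w - G z] into an integral over a horizontal and a vertical segment near [z], where [g]
    is close to [g z]. *)
Lemma exists_antiderivative g :
  (forall z, in_square 2 z -> {for z, continuous g}) ->
  (forall z, in_square 1 z -> z != 0 -> derivable g z 1) ->
  exists G : Cx R -> Cx R, forall z, in_square 1 z -> forall e : R, 0 < e ->
    exists2 d : R, 0 < d & forall w, cabs (w - z) < d ->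
      cabs (G w - G z - g z * (w - z)) <= e * cabs (w - z).
Proof.
move=> cg dg.
exists (fun z => cint (fun t => g (Complex t 0)) 0 (complex.Re z) +
  'i%C * cint (fun t => g (Complex (complex.Re z) t)) 0 (complex.Im z)).
move=> z [zx zy] e e0.
have e4 : 0 < e / 4 by rewrite divr_gt0.
have z2 : in_square 2 z by split; lra.
have [r r0 rP] := (continuous_cxP g z).1 (cg z z2) _ e4.
exists (Num.min (r / 4) (Num.min (1 - `|complex.Re z|) (1 - `|complex.Im z|))).
  by rewrite !lt_min divr_gt0//= !subr_gt0 zx zy.
move=> w; rewrite !lt_min => /andP[wr /andP[wx wy]].
have dx := Re_cabs (w - z); have dy := Im_cabs (w - z); rewrite ReB in dx; rewrite ImB in dy.
have [D DE] : exists D, D = cabs (w - z) by exists (cabs (w - z)).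
rewrite -DE in wr dx dy *.
have {wx} wx : `|complex.Re w| < 1.
  by have := ler_normD (complex.Re w - complex.Re z) (complex.Re z); rewrite subrK; lra.
have {wy} wy : `|complex.Im w| < 1.
  by have := ler_normD (complex.Im w - complex.Im z) (complex.Im z); rewrite subrK; lra.
clear DE.
case: z w => [x y] [x' y'] /= in zx zy z2 rP dx dy wx wy *.
rewrite !ltr_norml in zx zy wx wy.
have H1 := goursat_corner g x y cg dg zx zy.
have H2 := goursat_corner g x' y cg dg wx zy.
rewrite /rect_int in H1 H2.
have := @cint_approx R (fun t => g (Complex t y)) x x' (g (Complex x y)) 0 (e / 4)
  (horizontal_continuous g y zy cg) zx wx.
have := @cint_approx R (fun t => g (Complex x' t)) y y' (g (Complex x y)) 0 (e / 4)
  (vertical_continuous g x' wx cg) zy wy.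
rewrite !mul0r !addr0 => V H.
set c0 := g (Complex x y) in rP V H *.
rewrite (cint_cat _ 0 y y').
set h' := cint _ 0 x'; set v' := cint _ 0 y; set v := cint _ y y'.
set h := cint _ 0 x; set u := cint _ 0 y.
rewrite -/h' -/v' -/h -/u in H1 H2.
rewrite (cint_cat (fun t => g (Complex t y)) 0 x x') in H2.
set k := cint _ x x' in H2 H.
set Y := cint _ 0 x in H1 H2; set Z := cint _ 0 y in H1 H2.
have -> : h' + 'i%C * (v' + v) - (h + 'i%C * u) - c0 * (Complex x' y' - Complex x y) =
    (k - c0 * (x' - x)%:C%C) + 'i%C * (v - c0 * (y' - y)%:C%C).
  rewrite (complexE (Complex x' y')) (complexE (Complex x y)) /= complexiE.
  have E : h' + 'i%C * v' - (h + 'i%C * u) - k = 0.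
    transitivity (h' - (Y + k) + 'i%C * (v' - Z) - (h - Y + 'i%C * (u - Z))); first by ring.
    by rewrite H1 H2 subrr.
  rewrite !rmorphB -[RHS]addr0 -E complexiE; ring.
apply: le_trans (cabsD _ _) _; rewrite cabsM cabsi mul1r.
have {}V : cabs (v - c0 * (y' - y)%:C%C) <= 2 * (e / 4) * `|y' - y|.
  apply: V => t ty; rewrite mul0r addr0; apply/ltW/rP.
  apply: le_lt_trans (cabs_le_ReIm _) _; rewrite /=.
  by lra.
have {}H : cabs (k - c0 * (x' - x)%:C%C) <= 2 * (e / 4) * `|x' - x|.
  apply: H => t tx; rewrite mul0r addr0; apply/ltW/rP.
  apply: le_lt_trans (cabs_le_ReIm _) _; rewrite /= subrr normr0.
  by lra.
by nra.
Qed.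

End Goursat.

(** * The strong maximum principle *)

Section StrongMaximum.
Context {R : realType}.
Implicit Types f F G : Cx R -> Cx R.

Lemma is_derive_epsP (k : R -> R) (x l : R) : is_derive x 1 k l <->
  forall e : R, 0 < e -> exists2 d : R, 0 < d & forall y, `|y - x| < d ->
    `|k y - k x - l * (y - x)| <= e * `|y - x|.
Proof.
split=> [[/derivable1_diffP dk kl] e e0|H].
  have kx : (fun h => h^-1 *: (k (h *: 1 + x) - k x)) @ 0^' --> l.
    by rewrite -kl; apply: (derivable1_diffP k x).2 dk.
  move/cvgrPdist_le/(_ _ e0) : kx.
  rewrite /prop_near1 /dnbhs /within /= => /nbhs_ballP[d /= d0 dP]; exists d => // y yx.
  have [->|ynx] := eqVneq y x; first by rewrite !subrr mulr0 subr0 normr0 mulr0.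
  have := dP (y - x); rewrite -ball_normE/= sub0r normrN subr_eq0 => /(_ yx ynx).
  rewrite /GRing.scale/= mulr1 subrK distrC => h.
  have nz : y - x != 0 by rewrite subr_eq0.
  rewrite -[X in `|X - _|](mulVKf nz) (mulrC l) -mulrBr normrM mulrC.
  by rewrite ler_wpM2r.
have kl : (fun h => h^-1 *: (k (h *: 1 + x) - k x)) @ 0^' --> l.
  apply/cvgrPdist_le => e e0; have [d d0 dP] := H _ e0.
  rewrite /prop_near1 /dnbhs /within /=; apply/nbhs_ballP; exists d => //= h.
  rewrite -ball_normE/= sub0r normrN => hd h0.
  have := dP (h + x); rewrite addrK => /(_ hd).
  rewrite /GRing.scale/= mulr1 => Hh; rewrite distrC.
  have -> : h^-1 * (k (h + x) - k x) - l = h^-1 * (k (h + x) - k x - l * h).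
    by field.
  by rewrite normrM normfV mulrC ler_pdivrMr// normr_gt0.
by apply: DeriveDef; [apply/cvg_ex; exists l|apply: cvg_lim].
Qed.

Lemma derivable_cx_comp f F z :
  derivable F z 1 -> derivable f (F z) 1 -> derivable (f \o F) z 1.
Proof.
move=> /derivable1_diffP dF /derivable1_diffP df; apply/derivable1_diffP.
exact (differentiable_comp dF df).
Qed.

Definition cis (t : R) : Cx R := Complex (cos t) (sin t).

Lemma cabs_cis t : cabs (cis t) = 1.
Proof. by rewrite /cabs /= cos2Dsin2 sqrtr1. Qed.

Lemma cis_derive (x e : R) : 0 < e -> exists2 d : R, 0 < d & forall y, `|y - x| < d ->
  cabs (cis y - cis x - 'i%C * cis x * (y - x)%:C%C) <= e * `|y - x|.
Proof.
move=> e0; have e2 : 0 < e / 2 by rewrite divr_gt0.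
have [d d0 dP] := (is_derive_epsP cos x (- sin x)).1 (is_derive_cos x) _ e2.
have [d' d'0 dP'] := (is_derive_epsP sin x (cos x)).1 (is_derive_sin x) _ e2.
exists (Num.min d d') => [|y]; first by rewrite lt_min d0.
rewrite lt_min => /andP[/dP h1 /dP' h2].
apply: le_trans (cabs_le_ReIm _) _; rewrite /=.
rewrite !(mul0r, mulr0, mul1r, subr0, add0r, addr0).
by rewrite (_ : e = e / 2 + e / 2) ?mulrDl ?lerD//; lra.
Qed.

(** The linear part [l * z] is removed before dividing, so that the quotient is continuous at 0 and
    has an antiderivative; adding [l] and [l * z] back restores the original quotient, with value
    [l] at 0. *)
Lemma exists_divided_antiderivative F :
  (forall z, in_square 2 z -> derivable F z 1) ->
  exists G g, (forall z, z * g z = F z - F 0) /\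
    forall z, in_square 1 z -> forall e : R, 0 < e ->
      exists2 d : R, 0 < d & forall w, cabs (w - z) < d ->
        cabs (G w - G z - g z * (w - z)) <= e * cabs (w - z).
Proof.
move=> dF.
have o2 : in_square 2 (0 : Cx R) by split; rewrite /= normr0.
have /derivable_cxP[l dF0] := dF _ o2.
(* [h 0 = 0], because [0^-1 = 0], and this is also the limit of [h] at [0]. *)
pose h z : Cx R := (F z - F 0 - l * z) * z^-1.
have dh z : in_square 2 z -> z != 0 -> derivable h z 1.
  move=> z2 z0; apply: derivableM; last exact: derivableV.
  apply: derivableB; first by apply: derivableB => //; exact: dF.
  exact: derivableM.
have ch z : in_square 2 z -> {for z, continuous h}.
  move=> z2; have [->|z0] := eqVneq z 0; last exact/derivable_cx_continuous/dh.
  apply/continuous_cxP => e e0; have e2 : 0 < e / 2 by rewrite divr_gt0.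
  have [d d0 dP] := dF0 _ e2; exists d => // w wd.
  have -> : h 0 = 0 by rewrite /h invr0 mulr0.
  rewrite subr0; have [->|w0] := eqVneq w 0; first by rewrite /h invr0 mulr0 cabs0.
  have cw : 0 < cabs w by rewrite lt_neqAle cabs_ge0 andbT eq_sym cabs_eq0.
  rewrite /h cabsM cabsV ltr_pdivrMr//.
  have := dP w wd; rewrite subr0 => H; apply: le_lt_trans H _.
  by rewrite ltr_pM2r//; lra.
have [G HG] := exists_antiderivative h ch
  (fun z zs z0 => dh z (conj (lt_trans zs.1 (ltr1n R 2)) (lt_trans zs.2 (ltr1n R 2))) z0).
exists (fun z => G z + l * z), (fun z => h z + l); split=> [z|z z1 e e0].
  have [->|z0] := eqVneq z 0; first by rewrite mul0r subrr.
  by rewrite /h; field.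
have [d d0 dP] := HG z z1 e e0; exists d => // w /dP.
suff -> : G w + l * w - (G z + l * z) - (h z + l) * (w - z) =
  G w - G z - h z * (w - z) by [].
by ring.
Qed.

(* With [u = (F 0)^-1], the function [k t = Re (- i u G (zeta e^(it)))] has
   derivative [Re (u (F (zeta e^(it)) - F 0)) <= 0] and period [2 pi], hence is
   constant. *)
Lemma unit_disc_maximum F :
  (forall z, in_square 2 z -> derivable F z 1) -> F 0 != 0 ->
  (forall z, cabs z < 1 -> cabs (F z) <= cabs (F 0)) ->
  forall z, cabs z < 1 -> F z = F 0.
Proof.
move=> dF F0 Fmax zeta zeta1.
have [G [g [gE HG]]] := exists_divided_antiderivative F dF.
pose u := (F 0)^-1.
pose k t := complex.Re (- 'i%C * u * G (zeta * cis t)).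
pose k' t := complex.Re (u * (F (zeta * cis t) - F 0)).
have zc t : cabs (zeta * cis t) < 1 by rewrite cabsM cabs_cis mulr1.
have uF z : cabs z < 1 -> cabs (u * F z) <= 1.
  move=> z1; rewrite cabsM cabsV mulrC ler_pdivrMr ?mul1r ?Fmax//.
  by rewrite lt_neqAle cabs_ge0 andbT eq_sym cabs_eq0.
have uF0 : u * F 0 = 1 by rewrite mulVf.
(* Chain rule along the circle in remainder form: with [z = zeta * cis t], the derivative of
   [G (zeta * cis t)] in [t] is i times [z * g z = F z - F 0], and the factor -i in [k] cancels
   i. *)
have keps t (e : R) : 0 < e -> exists2 d : R, 0 < d & forall y, `|y - t| < d ->
    `|k y - k t - k' t * (y - t)| <= e * `|y - t|.
  move=> e0; set z := zeta * cis t.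
  have z1 : in_square 1 z.
    by split; [apply: le_lt_trans (Re_cabs _) _|apply: le_lt_trans (Im_cabs _) _]; exact: zc.
  pose M := cabs u + 1; pose N := cabs (g z) + 1.
  have M0 : 0 < M by rewrite ltr_wpDl// cabs_ge0.
  have N0 : 0 < N by rewrite ltr_wpDl// cabs_ge0.
  (* The remainders of [G] (with Lipschitz factor 2 for the curve) and of [cis] each contribute half
     of [e]; [M] and [N] absorb the factors [u] and [g z]. *)
  have e1 : 0 < e / (4 * M) by rewrite divr_gt0// mulr_gt0.
  have e2 : 0 < e / (2 * M * N) by rewrite divr_gt0// !mulr_gt0.
  have [d1 d10 dP1] := HG z z1 _ e1.
  have [d2 d20 dP2] := cis_derive t _ e2.
  have [d3 d30 dP3] := cis_derive t _ ltr01.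
  exists (Num.min (d1 / 2) (Num.min d2 d3)); first by rewrite !lt_min divr_gt0// d20.
  move=> y; rewrite !lt_min => /andP[y1 /andP[/dP2 y2 /dP3 y3]].
  have lip : cabs (zeta * cis y - z) <= 2 * `|y - t|.
    have : cabs (cis y - cis t) <= 2 * `|y - t|.
      have := cabsD (cis y - cis t - 'i%C * cis t * (y - t)%:C%C) ('i%C * cis t * (y - t)%:C%C).
      by rewrite subrK !cabsM cabsi cabs_cis cabs_real !mul1r; lra.
    rewrite /z -mulrBr cabsM; have := cabs_ge0 (cis y - cis t).
    by have := cabs_ge0 zeta; nra.
  have H1 : cabs (G (zeta * cis y) - G z - g z * (zeta * cis y - z)) <=
      e / (4 * M) * (2 * `|y - t|).
    apply: le_trans (dP1 _ _) _; first by lra.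
    by rewrite ler_wpM2l// ltW.
  have -> : k y - k t - k' t * (y - t) = complex.Re (- 'i%C * u *
      ((G (zeta * cis y) - G z - g z * (zeta * cis y - z)) +
       g z * zeta * (cis y - cis t - 'i%C * cis t * (y - t)%:C%C))).
    have ReZ (x : R) (w : Cx R) : complex.Re w * x = complex.Re (w * x%:C%C).
      by case: w => a b /=; rewrite mulr0 subr0.
    rewrite /k /k' ReZ -!ReB -/z -(gE z); congr complex.Re.
    have ii : 'i%C * 'i%C = -1 :> Cx R by rewrite -expr2 sqr_i.
    transitivity (- 'i%C * u * G (zeta * cis y) - - 'i%C * u * G z +
      'i%C * 'i%C * (u * (z * g z)) * (y - t)%:C%C); first by rewrite ii; ring.
    by rewrite /z; ring.
  apply: le_trans (Re_cabs _) _; rewrite !cabsM cabsN cabsi mul1r.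
  have {}y2 : cabs (g z * zeta * (cis y - cis t - 'i%C * cis t * (y - t)%:C%C)) <=
      N * (e / (2 * M * N) * `|y - t|).
    rewrite !cabsM; apply: ler_pM => //; rewrite ?mulr_ge0 ?cabs_ge0//.
    have := cabs_ge0 (g z); rewrite /N; have := cabs_ge0 zeta; nra.
  apply: le_trans (_ : M * (e / (4 * M) * (2 * `|y - t|) + N * (e / (2 * M * N) * `|y - t|)) <= _).
    apply: ler_pM; rewrite ?cabs_ge0//; first by rewrite /M lerDl.
    by apply: le_trans (cabsD _ _) _; exact: lerD.
  by rewrite le_eqVlt; apply/orP; left; apply/eqP; field; rewrite !gt_eqF.
have k'le t : k' t <= 0.
  rewrite /k' mulrBr uF0 ReB /= subr_le0.
  by apply: le_trans (ler_norm _) _; apply: le_trans (Re_cabs _) (uF _ (zc t)).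
have dk (t : R) : is_derive t 1 k (k' t) by apply/is_derive_epsP => e; exact: keps.
have kdec x y : x <= y -> k y <= k x.
  move=> xy; apply: (@ler0_derive1_nincr R k x y) => // [t _|].
  - by rewrite derive1E; have [_ ->] := dk t.
  - by apply: derivable_within_continuous => t _; have [] := dk t.
have kper t : k (t + 2 * pi) = k t.
  by rewrite /k /cis (_ : 2 * pi = pi *+ 2) ?cosD2pi ?sinD2pi// mulr_natl.
have pi0 := pi_gt0 R.
have kcst y : 0 <= y <= 2 * pi -> k y = k 0.
  move=> /andP[y0 y1]; apply/le_anti; rewrite kdec//=.
  by rewrite -(kper 0) kdec// add0r.
(* Constancy is known only to the right of 0; a positive increment [y] in the remainder estimate
   suffices. *)
have k'0 : k' 0 = 0.
  apply/eqP; rewrite -normr_eq0; apply/eqP/le_anti; rewrite normr_ge0 andbT.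
  apply/ler_addgt0Pr => e e0; rewrite add0r.
  have [d d0 dP] := keps 0 e e0.
  pose y := Num.min (d / 2) pi.
  have y0 : 0 < y by rewrite /y lt_min divr_gt0.
  have [yd yp] : y <= d / 2 /\ y <= pi by rewrite /y !ge_min !lexx !orbT.
  have := dP y; rewrite subr0 (gtr0_norm y0) => /(_ _).
  rewrite kcst ?subrr ?sub0r ?normrN ?normrM ?(gtr0_norm y0) ?ler_pM2r//.
    by apply; lra.
  by apply/andP; split; lra.
have c0 : cis 0 = 1 by rewrite /cis cos0 sin0.
(* A number of modulus at most 1 with real part 1 is 1. *)
have Re1 : complex.Re (u * F zeta) = 1.
  by move: k'0; rewrite /k' c0 mulr1 mulrBr uF0 ReB /= => /subr0_eq.
have Im0 : complex.Im (u * F zeta) = 0.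
  have := uF _ zeta1; rewrite -(@ler_pXn2r _ 2) ?nnegrE ?cabs_ge0//.
  rewrite sqr_cabs Re1 !expr1n gerDl => h.
  by apply/eqP; rewrite -sqrf_eq0 eq_le h sqr_ge0.
have : u * F zeta = 1.
  by apply/eqP; rewrite eq_complex Re1 Im0 /= !eqxx.
by rewrite -uF0 => /(mulfI _); apply; rewrite invr_eq0.
Qed.

Lemma local_maximum_constant f (c : Cx R) :
  (\forall z \near c, derivable f z 1 /\ cabs (f z) <= cabs (f c)) ->
  \forall z \near c, f z = f c.
Proof.
move=> /nbhs_cxP[r r0 rP].
(* The value 0 is treated apart, since [unit_disc_maximum] normalises by [F 0]. *)
have [fc0|fc0] := eqVneq (f c) 0.
  apply/nbhs_cxP; exists r => // z /rP[_]; rewrite fc0 cabs0 => fz.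
  by apply/eqP; rewrite -cabs_eq0 eq_le fz cabs_ge0.
(* Points of [in_square 2] have modulus less than 4, so the rescaled function is holomorphic
   there. *)
pose s : R := r / 4.
have s0 : 0 < s by rewrite divr_gt0.
have cs : cabs (s%:C%C : Cx R) = s by rewrite cabs_real gtr0_norm.
pose F z := f (c + s%:C%C * z).
have small z : cabs z < 4 -> cabs (c + s%:C%C * z - c) < r.
  by move=> z4; rewrite addrC addKr cabsM cs /s; nra.
have Fz z : cabs z < 1 -> F z = F 0.
  apply: unit_disc_maximum => [w [w1 w2]||w w1].
  - apply: (@derivable_cx_comp f (fun z => c + s%:C%C * z)).
      by apply: derivableD => //; exact: derivableM.
    apply: (rP _ _).1; apply: small.
    by apply: le_lt_trans (cabs_le_ReIm _) _; lra.
  - by rewrite /F mulr0 addr0.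
  - rewrite /F mulr0 addr0; apply: (rP _ _).2; apply: small.
    by apply: lt_trans w1 _; rewrite ltr1n.
apply/nbhs_cxP; exists s => // z zc.
have sC0 : s%:C%C != 0 :> Cx R by rewrite -cabs_eq0 cs gt_eqF.
have := Fz (s%:C%C^-1 * (z - c)); rewrite /F mulVKf// mulr0 addr0 (addrC c) subrK; apply.
by rewrite cabsM cabsV cs mulrC ltr_pdivrMr// mul1r.
Qed.

End StrongMaximum.

(** * The maximum principle and the identity theorem *)

Section MaximumPrinciple.
Context {R : realType}.
Implicit Types f g : Cx R -> Cx R.

Lemma cabs_dist_continuous (q : Cx R) : continuous (fun w => cabs (w - q)).
Proof.
move=> z A /nbhs_ballP[e e0 eA]; apply/nbhs_cxP; exists e => // w wz.
apply: eA; rewrite -ball_normE/= distrC.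
apply: le_lt_trans wz; rewrite ler_norml.
have := cabsBD w z q; have := cabsBD z w q; rewrite (cabsB z w) => ? ?.
by apply/andP; split; lra.
Qed.

Lemma compact_cabs_dist (q : Cx R) (A : set R) (r : R) :
  closed A -> (forall x, A x -> x <= r) -> compact [set w | A (cabs (w - q))].
Proof.
move=> cA Ar; apply: (@compact_cxP _ _ (r + cabs q)) => [|w /= /Ar wr].
  apply: (@preimage_closed _ _ (fun w => cabs (w - q)) A) => // w _.
  exact: cabs_dist_continuous.
have := cabsD (w - q) q; rewrite subrK => /le_trans; apply.
by rewrite lerD2r.
Qed.

Lemma closed_within_level (T : topologicalType) (Y : set T) (h : T -> R) (m : R) :
  closed Y -> {within Y, continuous h} -> closed (Y `&` [set x | h x = m]).
Proof.
move=> cY ch x clx.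
have Yx : Y x by apply: cY => B /clx[y [[Yy _] By]]; exists y.
split=> //=; apply: contrapT => hxm.
have nV : nbhs (h x) [set t | t <> m].
  apply: (open_nbhs_nbhs (conj _ hxm)).
  rewrite (_ : [set t | t <> m] = ~` [set m])//.
  by apply: closed_openC; exact: closed_eq.
have := (subspace_continuousP _ _).1 ch x Yx _ nV.
by move=> /clx[y [[Yy hy] /(_ Yy)]].
Qed.

(* The maximizers form a compact set; by the strong maximum principle it would be
   open if the conclusion failed, so it could not have a rightmost point. *)
Lemma compact_maximum_boundary (Y : set (Cx R)) g :
  compact Y -> Y !=set0 -> {within Y, continuous g} ->
  exists2 y, Y y & (forall x, Y x -> cabs (g x) <= cabs (g y)) /\
    ~ \forall x \near y, [/\ derivable g x 1, cabs (g x) <= cabs (g y) &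
                          cabs (g x) = cabs (g y) -> Y x].
Proof.
move=> cY Y0 cg.
have cag : {within Y, continuous (fun x => cabs (g x))}.
  by move=> x; apply: continuous_comp; [exact: cg|exact: cabs_continuous].
have [y0 /set_mem Yy0 y0max] := compact_EVT_max Y0 cY cag.
apply: contrapT => /forall2NP noy.
pose T := Y `&` [set x | cabs (g x) = cabs (g y0)].
have cT : compact T.
  apply: (subclosed_compact _ cY); last by move=> x [].
  by apply: closed_within_level => //; apply: compact_closed cY; exact: hausdorff_cx.
have Tmax x y : T y -> Y x -> cabs (g x) <= cabs (g y).
  by move=> [_ /= ->] Yx; apply: y0max; exact/mem_set.
have cRe : {within T, continuous (fun x : Cx R => complex.Re x)}.
  apply: continuous_subspaceT => x A /nbhs_ballP[e e0 eA]; apply/nbhs_cxP.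
  exists e => // w wx; apply: eA; rewrite -ball_normE/= distrC -ReB.
  exact: le_lt_trans (Re_cabs _) wx.
have T0 : T !=set0 by exists y0.
have [y /set_mem Ty ymax] := compact_EVT_max T0 cT cRe.
case: (noy y) => [[]|nyP]; first by case: Ty.
apply: nyP; split=> [x Yx|]; first exact: Tmax.
move=> near_y.
have gy : \forall x \near y, g x = g y.
  by apply: local_maximum_constant; apply: filterS near_y => x [].
have : \forall x \near y, T x.
  apply: filterS2 near_y gy => x [_ _ Yx] gxy.
  by split; [apply: Yx; rewrite gxy|rewrite /= gxy; case: Ty].
move=> /nbhs_cxP[e e0 /(_ (y + (e / 2)%:C%C))].
rewrite addrC addKr cabs_real gtr0_norm ?divr_gt0// ltr_pdivrMr// ltr_pMr// ltr1n.
move=> /(_ isT)/mem_set/ymax; rewrite ReD /= => ye.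
have e2 : 0 < e / 2 by rewrite divr_gt0.
lra.
Qed.

Lemma derivable_near_cst f z (c : Cx R) : (\forall w \near z, f w = c) -> derivable f z 1.
Proof.
move=> fc; apply: (@near_eq_derivable _ _ _ (cst c)); last exact: derivable_cst.
by apply: filterS fc => w ->.
Qed.

Lemma derivable_cx_mul f g z :
  derivable f z 1 -> derivable g z 1 -> derivable (fun w => f w * g w) z 1.
Proof. exact: derivableM. Qed.

Lemma derivable_cx_exp f z n : derivable f z 1 -> derivable (fun w => f w ^+ n) z 1.
Proof.
move=> df; elim: n => [|n IH].
  by apply: (@derivable_near_cst _ z 1); apply: filterE => w; rewrite expr0.
have -> : (fun w => f w ^+ n.+1) = (fun w => f w * f w ^+ n).
  by apply/funext => w; rewrite exprS.
exact: (derivable_cx_mul f (fun w => f w ^+ n)).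
Qed.

Lemma disc_maximum g (q : Cx R) (r r' M : R) : r' < r ->
  (forall z, cabs (z - q) < r -> derivable g z 1) ->
  (forall z, cabs (z - q) = r' -> cabs (g z) <= M) ->
  forall z, cabs (z - q) <= r' -> cabs (g z) <= M.
Proof.
move=> rr dg gM z zr.
pose Y := [set w | cabs (w - q) <= r'].
have cY : compact Y.
  by apply: (@compact_cabs_dist q [set x | x <= r'] r'); [exact: closed_le|].
have cg : {within Y, continuous g}.
  apply: continuous_in_subspaceT => w /set_mem/= wr.
  by apply: derivable_cx_continuous; apply: dg; exact: le_lt_trans rr.
have [y /= yr [ymax ybd]] := compact_maximum_boundary Y g cY (ex_intro _ z zr) cg.
apply: le_trans (ymax z zr) _; apply: gM; apply/eqP; rewrite eq_le yr /= leNgt.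
apply/negP => yr'; apply: ybd.
have : \forall x \near y, cabs (x - q) < r'.
  exact: (cvgr_lt _ (cabs_dist_continuous q y)).
apply: filterS => x xr; split=> [||_].
- by apply: dg; exact: lt_trans rr.
- by apply: ymax; exact: ltW.
- exact: ltW.
Qed.

(* Since [f = c] near [q], the function [(f - c) / (z - q) ^ m] is holomorphic
   for every [m]; the maximum principle gives [|f z - c| <= M (|z - q| / r')^m]. *)
Lemma disc_identity f (q c : Cx R) (r : R) :
  (forall z, cabs (z - q) < r -> derivable f z 1) ->
  (\forall z \near q, f z = c) -> forall z, cabs (z - q) < r -> f z = c.
Proof.
move=> df fq z zr.
have [->|zq] := eqVneq z q; first exact: nbhs_singleton fq.
have z0 : 0 < cabs (z - q).
  by rewrite lt_neqAle cabs_ge0 andbT eq_sym cabs_eq0 subr_eq0.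
pose r' := (cabs (z - q) + r) / 2.
have [zr' rr] : cabs (z - q) < r' /\ r' < r by rewrite /r'; split; lra.
have r'0 : 0 < r' by exact: lt_trans zr'.
have [M HM] : exists M, forall w, cabs (w - q) = r' -> cabs (f w - c) <= M.
  pose Y := [set w : Cx R | cabs (w - q) = r'].
  have cY : compact Y.
    by apply: (@compact_cabs_dist q [set x | x = r'] r'); [exact: closed_eq|move=> x /= ->].
  have cg : {within Y, continuous (fun w => cabs (f w - c))}.
    apply: continuous_in_subspaceT => w /set_mem/= wr.
    have fw : {for w, continuous f} by apply/derivable_cx_continuous/df; rewrite wr.
    exact: (continuous_comp fw (cabs_dist_continuous c (f w))).
  have [Y0|Y0] := pselect (Y !=set0).
    have [y _ ymax] := compact_EVT_max Y0 cY cg.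
    by exists (cabs (f y - c)) => w wr; apply: ymax; exact/mem_set.
  by exists 0 => w wr; case: Y0; exists w.
have step m : cabs (f z - c) <= M * (cabs (z - q) / r') ^+ m.
  pose h w := (f w - c) * (w - q)^-1 ^+ m.+1.
  have dh w : cabs (w - q) < r -> derivable h w 1.
    move=> wr; have [wq|wq] := eqVneq w q.
      apply: (@derivable_near_cst _ _ 0); rewrite wq; apply: filterS fq => t ft.
      by rewrite /h ft subrr mul0r.
    apply: derivableM; first by apply: derivableB => //; exact: df.
    apply: derivable_cx_exp.
    by apply: derivableV; [rewrite subr_eq0|exact: derivableB].
  have hM w : cabs (w - q) = r' -> cabs (h w) <= M / r' ^+ m.+1.
    move=> wr; rewrite /h cabsM cabsX cabsV wr exprVn ler_wpM2r ?HM//.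
    by rewrite invr_ge0 exprn_ge0// ltW.
  have := disc_maximum h q r r' _ rr dh hM z (ltW zr').
  rewrite /h cabsM cabsX cabsV exprVn ler_pdivrMr ?exprn_gt0// => H.
  (* A negative [M] would make the bound [H] on a modulus negative. *)
  have M0 : 0 <= M.
    apply: contraPT H; rewrite -ltNge => M0; apply/negP; rewrite -ltNge.
    apply: lt_le_trans (cabs_ge0 _).
    by rewrite -mulrA nmulr_rlt0// mulr_gt0 ?invr_gt0 ?exprn_gt0.
  apply: (le_trans H); rewrite -mulrA [_^-1 * _]mulrC -expr_div_n ler_wpM2l// exprS.
  have t0 : 0 <= cabs (z - q) / r' by rewrite divr_ge0// ltW.
  by rewrite ler_piMl ?exprn_ge0// ler_pdivrMr// mul1r ltW.
have lim0 : (fun m => M * (cabs (z - q) / r') ^+ m) @ \oo --> (M * 0 : R).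
  have t0 : 0 <= cabs (z - q) / r' by rewrite divr_ge0// ltW.
  by apply: cvgMr; apply: cvg_expr; rewrite ger0_norm// ltr_pdivrMr// mul1r.
apply/eqP; rewrite -subr_eq0 -cabs_eq0 eq_le cabs_ge0 andbT.
rewrite mulr0 in lim0; apply: (cvgr_to_ge lim0).
by near=> m; exact: step.
Unshelve. all: by end_near. Qed.

(** The set [P] of points near which [f] is [c] is open. It is relatively closed in [D]: a point [p]
    of [P] within [r / 2] of a limit point [z] has a disc in [D] that contains a neighbourhood of
    [z], and [disc_identity] applies on it. *)
Lemma connected_identity f (D : set (Cx R)) (q c : Cx R) :
  open D -> connected D -> holomorphic_on f D -> D q ->
  (\forall z \near q, f z = c) -> forall z, D z -> f z = c.
Proof.
move=> oD conD df Dq fq.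
pose P := [set z : Cx R | \forall w \near z, f w = c].
have oP : open P by rewrite openE => z /near_join.
have : D `&` P = D.
  apply: conD; [by exists q|by exists P|exists (closure P); first exact: closed_closure].
  apply/seteqP; split=> z [Dz Pz]; (split; first exact: Dz).
    exact: subset_closure.
  have [r r0 rD] := (open_cxP D).1 oD z Dz.
  have r2 : 0 < r / 2 by rewrite divr_gt0.
  have [|p [Pp /= pz]] := Pz [set w | cabs (w - z) < r / 2].
    by apply/nbhs_cxP; exists (r / 2).
  apply/nbhs_cxP; exists (r / 2 - cabs (p - z)); first by rewrite subr_gt0.
  move=> w wz; apply: (disc_identity f p c (r / 2) _ Pp).
    move=> t tp; apply/df/rD; apply: le_lt_trans (cabsBD _ p _) _; lra.
  apply: le_lt_trans (cabsBD _ z _) _; rewrite (cabsB z p); lra.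
by move=> DP z; rewrite -DP => -[_ /nbhs_singleton].
Qed.

End MaximumPrinciple.

(** * Monotonicity of [MD] on a direct tract *)

Section Tract.
Context {R : realType} (f : Cx R -> Cx R) (D : set (Cx R)) (Rt rho0 : R).
Hypothesis tractD : direct_tract f D Rt.
Hypothesis Rt_rho0 : Rt < rho0.
Hypothesis MD_gt : forall rho, rho0 < rho -> rho < MD f D rho.

Lemma tract_cabs_continuous : {within closure D, continuous (fun z => cabs (f z))}.
Proof.
case: tractD => _ [_ [_ [_ [_ [cf _]]]]] x.
by apply: continuous_comp; [exact: cf|exact: cabs_continuous].
Qed.

Lemma tract_gt z : closure D z -> Rt < cabs (f z) -> D z.
Proof.
case: tractD => _ [_ [_ [_ [_ [_ [_ [bd _]]]]]]] clz fz.
by apply: contrapT => Dz; rewrite bd ?ltxx// in fz.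
Qed.

(** A supremum bounds its set only if the set is bounded above; this comes from the compactness of
    the part of the circle in [closure D], where [f] is continuous. *)
Lemma MD_circle z : D z -> cabs (f z) <= MD f D (cabs z).
Proof.
move=> Dz; set r := cabs z.
pose Y := closure D `&` [set w | cabs w = r].
have cY : compact Y.
  apply: (@compact_cxP _ _ r); last by move=> w [_ /= ->].
  apply: closedI; first exact: closed_closure.
  apply: (@preimage_closed _ _ (@cabs R) [set x | x = r]); last exact: closed_eq.
  by move=> w _; exact: cabs_continuous.
have cf : {within Y, continuous (fun z => cabs (f z))}.
  by apply: continuous_subspaceW tract_cabs_continuous => w [].
have Y0 : Y !=set0 by exists z; split=> //; exact: subset_closure.
have [y _ ymax] := compact_EVT_max Y0 cY cf.
apply: ub_le_sup; last by exists z.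
exists (cabs (f y)) => _ [w [Dw wr] <-]; apply: ymax; apply/mem_set.
by split=> //; exact: subset_closure.
Qed.

(** A maximum over the disc exceeding [MD f D r], which is greater than [r] and so than [Rt], is
    attained neither on the boundary of [D] nor on the circle, against the maximum principle. *)
Lemma MD_disc r z : rho0 < r -> D z -> cabs z <= r -> cabs (f z) <= MD f D r.
Proof.
move=> r0 Dz zr; have [[_ [oD _]] [_ [_ [_ [df [cf [Rt0 _]]]]]]] := tractD.
pose Y := closure D `&` [set w | cabs w <= r].
have cY : compact Y.
  apply: (@compact_cxP _ _ r); last by move=> w [].
  apply: closedI; first exact: closed_closure.
  apply: (@preimage_closed _ _ (@cabs R) [set x | x <= r]); last exact: closed_le.
  by move=> w _; exact: cabs_continuous.
have {}cf : {within Y, continuous f} by apply: continuous_subspaceW cf => w [].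
have Yz : Y z by split=> //; exact: subset_closure.
have [y [cly yr] [ymax ybd]] := compact_maximum_boundary Y f cY (ex_intro _ z Yz) cf.
apply: le_trans (ymax z Yz) _; rewrite leNgt; apply/negP => Mfy; apply: ybd.
have Mr := MD_gt r r0.
have Dy : D y.
  by apply: tract_gt => //; exact: lt_trans Rt_rho0 (lt_trans r0 (lt_trans Mr Mfy)).
have {}yr : cabs y < r.
  rewrite lt_neqAle yr andbT; apply/eqP => yr'.
  by have := MD_circle y Dy; rewrite yr'; lra.
have : \forall x \near y, D x /\ cabs x < r.
  near=> x; split; near: x; first by rewrite openE in oD; exact: oD.
  exact: (cvgr_lt _ (cabs_continuous y)).
apply: filterS => x [Dx xr].
have Yx : Y x by split; [exact: subset_closure|exact: ltW].
by split; [exact: df|exact: ymax|move=> _; exact: Yx].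
Unshelve. all: by end_near. Qed.

(** Equality would be a local maximum, making [f] constant on [D]; then [MD f D s] could not exceed
    an [s] larger than that constant modulus. *)
Lemma MD_disc_lt r z : rho0 < r -> D z -> cabs z < r -> cabs (f z) < MD f D r.
Proof.
move=> r0 Dz zr; have [[_ [oD conD]] [_ [_ [_ [df _]]]]] := tractD.
rewrite ltNge; apply/negP => Mfz.
have fz : \forall w \near z, f w = f z.
  apply: local_maximum_constant.
  have : \forall x \near z, D x /\ cabs x < r.
    near=> x; split; near: x; first by rewrite openE in oD; exact: oD.
    exact: (cvgr_lt _ (cabs_continuous z)).
  apply: filterS => x [Dx xr]; split; first exact: df.
  by apply: le_trans Mfz; apply: MD_disc => //; exact: ltW.
have fcst := connected_identity f D z (f z) oD conD df Dz fz.
pose s := Num.max r (cabs (f z)) + 1.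
have rs : r < s by rewrite /s ltr_pwDr// le_max lexx.
have fs : cabs (f z) < s by rewrite /s ltr_pwDr// le_max lexx orbT.
have := MD_gt s (lt_trans r0 rs); apply/negP; rewrite -leNgt; apply: le_trans (ltW fs).
rewrite /MD; set B := image _ _.
(* If the circle of radius [s] misses [D], the supremum takes its default value 0. *)
have [B0|B0] := pselect (B !=set0).
  by apply: ge_sup => // _ [w [Dw _] <-]; rewrite fcst.
have -> : B = set0 by apply: contrapT => /eqP/set0P.
by rewrite sup0 cabs_ge0.
Unshelve. all: by end_near. Qed.

End Tract.

(** * Components of compact plane sets *)

Section Components.
Context {R : realType}.

(** The traces on [Y] of the sets [B i] generate a proper filter, and a cluster point of it lies in
    every closed [B i]. *)
Lemma compact_directed (T : topologicalType) (Y : set T) (I : Type) (P : set I)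
    (B : I -> set T) :
  compact Y -> (exists i, P i) ->
  (forall i j, P i -> P j -> exists2 k, P k & B k `<=` B i `&` B j) ->
  (forall i, P i -> closed (B i)) -> (forall i, P i -> (Y `&` B i) !=set0) ->
  exists2 p, Y p & forall i, P i -> B i p.
Proof.
move=> cY P0 Bdir Bcl B0.
pose F := filter_from P (fun i => Y `&` B i).
have FF : ProperFilter F.
  apply: filter_from_proper => //; apply: filter_from_filter => // i j Pi Pj.
  have [k Pk Bk] := Bdir i j Pi Pj; exists k => // x [Yx /Bk[Bi Bj]].
  by split.
have [|p [Yp clp]] := cY F FF; first by have [i Pi] := P0; exists i => // x [].
exists p => // i Pi; apply: (Bcl i Pi) => N /(clp (Y `&` B i)) H.
have [|x [[_ Bx] Nx]] := H; first by exists i.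
by exists x.
Qed.

(** Inside a compact disc containing [A] in its interior, normality gives a neighbourhood [E] of [A]
    whose closure misses [B]; the complement of that closure serves as [V]. *)
Lemma cx_separation (A B : set (Cx R)) : compact A -> closed B -> A `&` B = set0 ->
  exists U V, [/\ open U, open V, A `<=` U, B `<=` V & U `&` V = set0].
Proof.
move=> cA cB AB.
have [M AM] : exists M, forall w, A w -> cabs w < M.
  have [A0|A0] := pselect (A !=set0); last by exists 0 => w Aw; case: A0; exists w.
  have [y _ ymax] := compact_EVT_max A0 cA (continuous_subspaceT (@cabs_continuous R)).
  exists (cabs (y : Cx R) + 1) => w Aw; rewrite ltr_pwDr//.
  exact/ymax/mem_set.
pose K := [set w : Cx R | cabs w <= M].
have AK : A `<=` interior K.
  move=> w /AM wM; apply: filterS (cvgr_lt _ (@cabs_continuous R w) _ wM) => x.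
  exact: ltW.
have clA : closed A by apply: compact_closed cA; exact: hausdorff_cx.
have nA : set_nbhs A (~` B).
  apply/set_nbhsP; exists (~` B); split => //; first exact: closed_openC.
  by apply/disjoints_subset.
have [E nE EB] := compact_normal_local hausdorff_cx (@compact_cabs_le R M) AK clA nA.
have /set_nbhsP[U [oU AU UE]] := nE.
exists U, (~` closure E); split => //.
- exact/closed_openC/closed_closure.
- by move=> w Bw clw; apply: (EB w clw).
- by rewrite -subset0 => w [Uw]; apply; exact/subset_closure/UE.
Qed.

(* In a compact set components and quasi-components coincide: the intersection of
   the relatively clopen sets containing [z] is connected. *)
Lemma component_clopen (Y S : set (Cx R)) (z : Cx R) :
  compact Y -> closed S -> Y z -> connected_component Y z `&` S = set0 ->
  exists C, [/\ C z, closed C, C `<=` Y, closed (Y `\` C) & C `&` S = set0].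
Proof.
move=> cY cS Yz KS.
have clY : closed Y by apply: compact_closed cY; exact: hausdorff_cx.
pose P := [set C : set (Cx R) | [/\ C z, closed C, C `<=` Y & closed (Y `\` C)]].
have PY : P Y by split => //; rewrite setDv; exact: closed0.
have Pdir C1 C2 : P C1 -> P C2 -> exists2 C, P C & C `<=` C1 `&` C2.
  move=> [z1 cl1 s1 d1] [z2 cl2 s2 d2]; exists (C1 `&` C2) => //; split => //.
  - exact: closedI.
  - by move=> w [/s1].
  - by rewrite setDIr; exact: closedU.
(* By compactness, a closed set missed by the intersection of the directed family [P] is missed by
   one of its members. *)
have shrink (F : set (Cx R)) : closed F -> (forall w, (forall C, P C -> C w) -> ~ F w) ->
    exists2 C, P C & C `&` F = set0.
  move=> cF QF; apply: contrapT => /forall2NP H.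
  have PF C : P C -> ((Y `&` F) `&` C) !=set0.
    move=> PC; case: (H C) => [//|/eqP/set0P[w [Cw Fw]]]; exists w; split=> //.
    by split=> //; case: PC => _ _ + _; exact.
  have Pcl C : P C -> closed C by case.
  have [p Fp Qp] := @compact_directed _ _ _ P id (compact_closedI cY cF)
    (ex_intro _ Y PY) Pdir Pcl PF.
  by case: (QF p Qp); case: Fp.
pose Q := \bigcap_(C in P) C.
have QY : Q `<=` Y by move=> w /(_ Y PY).
have Qz : Q z by move=> C [].
have clQ : closed Q by apply: closed_bigI => C [].
(* Separate the two pieces by open [U] and [V] and take a member [C] of [P] inside their union: then
   [C] minus [V] is again in [P], so it contains [Q], yet it misses [E2]. *)
have split_empty (E1 E2 : set (Cx R)) : closed E1 -> closed E2 -> E1 `&` E2 = set0 ->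
    Q = E1 `|` E2 -> E1 z -> E2 = set0.
  move=> c1 c2 E12 QE z1.
  have cE1 : compact E1.
    by apply: (subclosed_compact c1 cY); apply: subset_trans QY; rewrite QE; left.
  have [U [V [oU oV E1U E2V UV]]] := cx_separation E1 E2 cE1 c2 E12.
  have [||C [Cz clC CY cYC] CUV] := shrink (~` (U `|` V)).
  - by apply: open_closedC; exact: openU.
  - move=> w Qw; apply; have : Q w by [].
    by rewrite QE => -[/E1U|/E2V]; [left|right].
  have CUVs w : C w -> U w \/ V w.
    move=> Cw; apply: contrapT => nUV.
    by have : (C `&` ~` (U `|` V)) w by []; rewrite CUV.
  have PCV : P (C `\` V).
    split.
    - split=> // Vz; have : (U `&` V) z by split=> //; exact: E1U.
      by rewrite UV.
    - by apply: closedI => //; exact: open_closedC.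
    - by move=> w [/CY].
    - have -> : Y `\` (C `\` V) = (Y `\` C) `|` (C `\` U).
        apply/seteqP; split=> [w [Yw nCV]|w [[Yw nC]|[Cw nU]]].
        + have [Cw|nC] := pselect (C w); last by left.
          right; split=> // Uw; apply: nCV; split=> // Vw.
          by have : (U `&` V) w by []; rewrite UV.
        + by split=> // -[].
        + by split=> [|[_]]; [exact: CY|have [] := CUVs w Cw].
      by apply: closedU => //; apply: closedI => //; exact: open_closedC.
  rewrite -subset0 => w E2w.
  have : Q w by rewrite QE; right.
  by move=> /(_ _ PCV)[_]; apply; exact: E2V.
have conQ : connected Q.
  move=> B [b Bb] [W oW BW] [F cF BF].
  have clB : closed B by rewrite BF; exact: closedI.
  have clQB : closed (Q `\` B).
    have -> : Q `\` B = Q `&` ~` W.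
      rewrite BW; apply/seteqP; split=> w [Qw nB]; split=> //; last by move=> [].
      by move=> Ww; apply: nB.
    by apply: closedI => //; exact: open_closedC.
  have BQ : B `<=` Q by rewrite BW => w [].
  have QE : Q = B `|` (Q `\` B) by rewrite setDUK.
  have dis : B `&` (Q `\` B) = set0 by rewrite setDIK.
  have [Bz|nBz] := pselect (B z).
    have E := split_empty B (Q `\` B) clB clQB dis QE Bz.
    by rewrite [RHS]QE E setU0.
  have E : B = set0.
    apply: (split_empty (Q `\` B) B) => //; first by rewrite setIC.
    by rewrite setUC.
  by move: Bb; rewrite E.
have QK : Q `<=` connected_component Y z by exact: connected_component_max.
have [|C [Cz clC CY cYC] CS] := shrink S cS; last by exists C; split.
move=> w Qw Sw; have : (connected_component Y z `&` S) w by split=> //; exact: QK.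
by rewrite KS.
Qed.

End Components.

(** * The closed sets whose intersection is [A_set] *)

Section Levels.
Context {R : realType} (f : Cx R -> Cx R) (D : set (Cx R)) (Rt rho0 : R).
Hypothesis tractD : direct_tract f D Rt.
Hypothesis Rt_rho0 : Rt < rho0.
Hypothesis MD_gt : forall rho, rho0 < rho -> rho < MD f D rho.

(** The recursion moves to the image point and to the radius [MD f D rho]. The last iterate is only
    required to be large; its membership in [D] enters one level later. *)
Fixpoint level (n : nat) (rho : R) : set (Cx R) :=
  if n is m.+1 then [set z | [/\ D z, rho <= cabs z & level m (MD f D rho) (f z)]]
  else [set z | rho <= cabs z].

Lemma level_ge n rho z : level n rho z -> rho <= cabs z.
Proof. by case: n => [|n] //= []. Qed.

Lemma levelP n rho z : level n rho z <->
  (forall k, (k < n)%N -> D (iter k f z)) /\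
  (forall k, (k <= n)%N -> iter k (MD f D) rho <= cabs (iter k f z)).
Proof.
elim: n rho z => [|n IH] rho z /=.
  by split=> [zr|[_ /(_ 0%N)]]; [split=> // -[]|exact].
split=> [[Dz zr /IH[H1 H2]]|[H1 H2]].
  by split=> -[|k] // kn; rewrite !iterSr; [exact: H1|exact: H2].
split; [exact: (H1 0%N)|exact: (H2 0%N)|apply/IH; split=> k kn].
  by rewrite -iterSr; exact: H1.
by rewrite -!iterSr; exact: H2.
Qed.

Lemma level_mono n m rho : (n <= m)%N -> level m rho `<=` level n rho.
Proof.
move=> nm z /levelP[H1 H2]; apply/levelP; split=> k kn.
  by apply: H1; exact: leq_trans nm.
by apply: H2; exact: leq_trans nm.
Qed.

Lemma A_set_level rho : A_set f D rho = \bigcap_n level n rho.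
Proof.
apply/seteqP; split=> [z [Dz H] n _|z H].
  by apply/levelP; split=> k _; have [] := H k.
split=> [|n]; first by have [] := H 1%N I.
by have /levelP[H1 H2] := H n.+1 I; split; [exact: H1|exact: H2].
Qed.

(** Although [D] is open, a limit point stays in [D]: it lies in [closure D], and the modulus of [f]
    there is at least [MD f D rho], greater than the boundary value [Rt]. *)
Lemma closed_level n rho : rho0 < rho -> closed (level n rho).
Proof.
elim: n rho => [|n IH] rho rho_gt /=.
  apply: (@preimage_closed _ _ (@cabs R) [set x | rho <= x]); last exact: closed_ge.
  by move=> z _; exact: cabs_continuous.
have MDrho := MD_gt rho rho_gt.
have clge : closed [set z : Cx R | rho <= cabs z].
  apply: (@preimage_closed _ _ (@cabs R) [set x | rho <= x]); last exact: closed_ge.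
  by move=> z _; exact: cabs_continuous.
move=> z clz.
have clDz : closure D z by apply: closureS clz => w [].
have lfz : level n (MD f D rho) (f z).
  apply: (IH _ (lt_trans rho_gt MDrho)) => B nB.
  case: tractD => _ [_ [_ [_ [_ [cf _]]]]].
  have := (subspace_continuousP _ _).1 cf z clDz _ nB.
  move=> /clz[w [[Dw _ lw] /(_ (subset_closure Dw)) Bw]].
  by exists (f w).
split=> //; last by apply: clge; apply: closureS clz => w [].
apply: (tract_gt f D Rt tractD z clDz).
apply: lt_le_trans (level_ge _ _ _ lfz).
exact: lt_trans Rt_rho0 (lt_trans rho_gt MDrho).
Qed.

(** Once an iterate falls below its threshold, [MD_disc_lt] keeps all later ones below theirs. *)
Lemma iter_lt_of_not_level n rho z : rho0 < rho ->
  (forall k, (k < n)%N -> D (iter k f z)) -> ~ level n rho z ->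
  cabs (iter n f z) < iter n (MD f D) rho.
Proof.
elim: n rho z => [|n IH] rho z rho_gt Dk nl.
  by rewrite ltNge; apply/negP.
have Dz : D z by exact: (Dk 0%N).
rewrite !iterSr.
apply: IH => [|k kn|lfz]; first exact: lt_trans rho_gt (MD_gt _ rho_gt).
  by rewrite -iterSr; exact: Dk.
apply: nl; split=> //; rewrite leNgt; apply/negP => zr.
have := level_ge _ _ _ lfz; apply/negP; rewrite -ltNge.
exact: (MD_disc_lt f D Rt rho0).
Qed.

Lemma iter_derivable n z :
  (forall k, (k < n)%N -> D (iter k f z)) -> derivable (iter n f) z 1.
Proof.
case: tractD => _ [_ [_ [_ [df _]]]].
elim: n => [|n IH] Dk; first exact: derivable_id.
apply: (@derivable_cx_comp _ f (iter n f)); last exact/df/Dk.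
by apply: IH => k kn; apply: Dk; exact: ltnW.
Qed.

Lemma iter_near n z : (forall k, (k < n)%N -> D (iter k f z)) ->
  \forall w \near z, forall k, (k < n)%N -> D (iter k f w).
Proof.
case: (tractD) => -[_ [oD _]] _.
elim: n => [|n IH] Dk; first exact: filterE.
have Dn : forall k, (k < n)%N -> D (iter k f z) by move=> k kn; apply: Dk; exact: ltnW.
have cn := derivable_cx_continuous _ _ (iter_derivable n z Dn).
have nD : nbhs (iter n f z) D by rewrite openE in oD; exact/oD/Dk.
apply: filterS2 (IH Dn) (cn _ nD) => w Hw Dw k.
by rewrite ltnS leq_eqVlt => /orP[/eqP ->|/Hw].
Qed.

End Levels.

(** * A bounded component contradicts the maximum principle for an iterate *)

Theorem theorem3p3 (R : realType) (f : Cx R -> Cx R) (D : set (Cx R)) (Rt : R)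
  (rho0 : R) :
  direct_tract f D Rt ->
  Rt < rho0 ->
  (forall rho, rho0 < rho -> rho < MD f D rho) ->
  forall rho, rho0 < rho ->
  forall z, A_set f D rho z -> unbounded (connected_component (A_set f D rho) z).
Proof.
move=> tractD Rt_rho0 MD_gt rho rho_gt z Az M.
apply: contrapT => /forallNP compM.
set A := A_set f D rho in Az compM.
have cl n := closed_level f D Rt rho0 tractD Rt_rho0 MD_gt n rho rho_gt.
have clA : closed A by rewrite /A A_set_level; apply: closed_bigI => n _.
(* The component has modulus at most [M]; cutting at [M + 1] leaves a margin, so the component of
   [z] in the compact piece [Y] misses [S]. *)
pose S := [set w : Cx R | M + 1 <= cabs w].
have clS : closed S.
  apply: (@preimage_closed _ _ (@cabs R) [set x | M + 1 <= x]); last exact: closed_ge.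
  by move=> w _; exact: cabs_continuous.
pose Y := A `&` [set w | cabs w <= M + 1].
have clB : closed [set w : Cx R | cabs w <= M + 1].
  apply: compact_closed (@compact_cabs_le R _); exact: hausdorff_cx.
have cY : compact Y by apply: (@compact_cxP _ _ (M + 1)) => [|w []//]; exact: closedI.
have small w : connected_component A z w -> cabs w <= M.
  by move=> Kw; rewrite leNgt; apply/negP => wM; apply: (compM w).
have Yz : Y z.
  split=> //=; have := small z (connected_component_refl Az); lra.
have YS : connected_component Y z `&` S = set0.
  rewrite -subset0 => w [Kw Sw].
  have : connected_component A z w.
    apply: (connected_component_max (B := connected_component Y z)) Kw.
    - exact: connected_component_refl.
    - by move=> v /connected_component_sub[].
    - exact: component_connected.
  by move/small; move: Sw; rewrite /S /=; lra.
have [C [Cz clC CY clYC CS]] := component_clopen Y S z cY clS Yz YS.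
have notS w : C w -> cabs w < M + 1.
  move=> Cw; rewrite ltNge; apply/negP => Sw.
  by have : (C `&` S) w by []; rewrite CS.
(* As [C] stays strictly inside the cutting circle, it is relatively open in all of [A], not only in
   [Y]. *)
have clAC : closed (A `\` C).
  have -> : A `\` C = (Y `\` C) `|` (A `&` S).
    apply/seteqP; split=> [w [Aw nC]|w [[[Aw _] nC]|[Aw Sw]]].
    - have [wM|wM] := leP (cabs w) (M + 1); first by left; split.
      by right; split=> //; exact: ltW.
    - by split.
    - by split=> // /notS; rewrite ltNge => /negP.
  by apply: closedU => //; exact: closedI.
have cC : compact C by exact: subclosed_compact clC cY CY.
have [U [V [oU oV CU AV UV]]] : exists U V,
    [/\ open U, open V, C `<=` U, A `\` C `<=` V & U `&` V = set0].
  by apply: cx_separation => //; rewrite setDIK.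
pose O := U `&` [set w | cabs w < M + 1].
have oO : open O.
  apply: openI => //; apply: (@open_comp _ _ (@cabs R) [set x | x < M + 1]).
    by move=> w _; exact: cabs_continuous.
  exact: open_lt.
have Oz : O z by split; [exact: CU|exact: notS].
have clO w : closure O w -> cabs w <= M + 1.
  by move=> Ow; apply: clB; apply: closureS Ow => v [_ /ltW].
pose Bd := closure O `&` ~` O.
have cBd : compact Bd.
  apply: (@compact_cxP _ _ (M + 1)) => [|w [/clO]//].
  by apply: closedI; [exact: closed_closure|exact: open_closedC].
(* A point of [A] in [Bd] can lie neither in [C], contained in [O], nor in the rest of [A],
   contained in the open set [V] disjoint from [O]. *)
have BdA w : Bd w -> ~ A w.
  move=> [clw nO] Aw; have [Cw|nC] := pselect (C w).
    by apply: nO; split; [exact: CU|exact: notS].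
  have Vw : V w by exact: AV.
  have [|v [[Uv _] Vv]] := clw V; first exact: open_nbhs_nbhs.
  by have : (U `&` V) v by []; rewrite UV.
have [n Bdn] : exists n, Bd `&` level f D n rho = set0.
  apply: contrapT => /forallNP H.
  have [||||p Bdp lp] := @compact_directed _ Bd nat setT (fun n => level f D n rho) cBd.
  - by exists 0%N.
  - move=> i j _ _; exists (maxn i j) => // w lw.
    by split; apply: level_mono lw; rewrite ?leq_maxl ?leq_maxr.
  - by move=> n _; exact: cl.
  - by move=> n _; exact/set0P/eqP/H.
  by apply: (BdA p Bdp); rewrite /A A_set_level.
pose Z := level f D n rho `&` closure O.
have ZO w : Z w -> O w.
  move=> [lw clw]; apply: contrapT => nO.
  by have : (Bd `&` level f D n rho) w by []; rewrite Bdn.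
have cZ : compact Z.
  apply: (@compact_cxP _ _ (M + 1)) => [|w [_ /clO]//].
  by apply: closedI; [exact: cl|exact: closed_closure].
have Zz : Z z.
  split; last exact: subset_closure.
  by move: Az; rewrite /A A_set_level; apply.
have cg : {within Z, continuous (iter n f)}.
  apply: continuous_in_subspaceT => w /set_mem[/levelP[Dw _] _].
  exact/derivable_cx_continuous/(iter_derivable f D Rt tractD).
have [y [ly cly] [ymax ybd]] :=
  compact_maximum_boundary Z (iter n f) cZ (ex_intro _ z Zz) cg.
have /levelP[Dy yge] := ly; apply: ybd.
have nO : \forall x \near y, O x.
  by apply: open_nbhs_nbhs; exact: (conj oO (ZO y (conj ly cly))).
apply: filterS2 nO (iter_near f D Rt tractD n y Dy) => x Ox Dx.
(* Off the level the iterate is strictly below the threshold that [y] reaches, so a nearby point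
   attaining the maximum must lie in [Z]. *)
have xlt : ~ level f D n rho x -> cabs (iter n f x) < cabs (iter n f y).
  move=> nl; apply: lt_le_trans (yge n (leqnn n)).
  exact: (iter_lt_of_not_level f D Rt rho0 tractD Rt_rho0 MD_gt).
have clx : closure O x by exact: subset_closure.
split; first exact: (iter_derivable f D Rt tractD).
  have [lx|/xlt/ltW xy] := pselect (level f D n rho x); last exact: xy.
  exact: ymax x (conj lx clx).
move=> E; have [lx|/xlt xy] := pselect (level f D n rho x); first exact: conj lx clx.
exfalso; have /eqP nE := lt_eqF xy; exact: nE E.
Qed.
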